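(* Let $r>0$, $b\neq0$, and consider the optimal control problem $$V(x_0)=\inf_{u\in\mathcal U}\int_0^\infty\{Q(x)+ru^2\}\,dt\quad\text{s.t.}\quad \dot x_1=f_1(x_2),\quad \dot x_2=f_2(x_1,x_2)+bu,\quad x(0)=x_0 .$$ Assume that $f_1(x_2)$ and $f_2(x_1,x_2)=f_{21}(x_1)+f_{22}(x_1,x_2)$ are continuous, with $f_1(0)=0$, $f_{22}(0,0)=0$, and that $f_1,f_{21}$ are not identically zero. Let $k$ be a real constant. If $Q$ is of the form $$Q(x_1,x_2)=rk^2f_1^2(x_2)+2b^{-1}rk\,f_1(x_2)f_{22}(x_1,x_2)$$ and for all $x_1,x_2$ $$b^{-1}k\,f_1(x_2)f_{22}(x_1,x_2)\ge 0,$$ then the control input $u=u_2(x_2)=kf_1(x_2)$ is an optimal solution of the optimal control problem, and the corresponding value function is $$V(x_1,x_2)=-2b^{-1}rk\left(\int_0^{x_2} f_1(s)\,ds-\int_0^{x_1} f_{21}(s)\,ds\right).$$ Furthermore, if $f_1,f_{21}$ are of class $\mathcal C^1$ and $$b^{-1}kf_1'(x_2)<0\ \text{ for } x_2\neq0,\qquad b^{-1}kf_{21}'(x_1)>0\ \text{ for } x_1\neq 0,$$ then $V$ is positive definite and it is a local Lyapunov function for the closed-loop system. The function $V$ is a global Lyapunov function if it is radially unbounded. Finally, the trajectories of the closed-loop system converge to one of the minimizers of $L(x_1,x_2,u)=Q(x_1,x_2)+ru^2$ (evaluated with $u=u_2(x_2)$). If $L$ is convex, then the trajectories converge to the origin for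 all initial conditions.
   Context: Here $x(t)=[x_1(t)\ x_2(t)]^T\in\mathbb R^2$; $\mathcal U$ is the set of allowable inputs, which are Lebesgue integrable functions. Standing assumptions: $V$ is of class $\mathcal C^1$, $Q(x)\ge0$, $Q(0)=0$, $r>0$, $b\neq0$; $f_1,f_2$ are continuous, not identically zero, and vanish at the origin. The closed-loop system is the system with $u=kf_1(x_2)$ substituted. The value function is normalized by $V(0)=0$. A local (global) Lyapunov function is a function positive definite in a neighbourhood of the origin (globally positive definite and radially unbounded) whose derivative along closed-loop trajectories is nonpositive.
   Formalization: Optimality in the first paragraph is proved at x_0 if a closed-loop solution exists and V(x(t)) tends to 0 along closed-loop and finite-cost trajectories (false otherwise); neither is assumed under the ''Furthermore'' conditions, which are also assumed for the ''Finally'' part. *)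

(* Defs.v *)
(* MathComp-Analysis world: abstract R : realType, Lebesgue integration. *)
From HB Require Import structures.
From mathcomp Require Import all_boot all_order all_algebra.
From mathcomp Require Import all_classical all_reals all_analysis.

Set Implicit Arguments.
Unset Strict Implicit.
Unset Printing Implicit Defensive.

Import Order.TTheory GRing.Theory Num.Theory.
Import numFieldNormedType.Exports.

Local Open Scope classical_set_scope.
Local Open Scope ring_scope.

(* Oriented integral from 0 to x, so that x may be negative; the library's
   integral is over a set and `[0, x] is empty when x < 0. *)
Definition integral_from0 (R : realType) (f : R -> R) (x : R) : R :=
  if 0 <= x then \int[lebesgue_measure]_(s in `[0, x]) f s
  else - \int[lebesgue_measure]_(s in `[x, 0]) f s.

Definition C1 (R : realType) (f : R -> R) : Prop :=
  (forall s, derivable f s 1) /\ continuous (derive1 f).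

(* Inputs live on the unbounded time axis [0, +oo[, and Lebesgue integrability
   is required on every bounded horizon, which is what is needed for the state
   equation to make sense. *)
Definition allowable (R : realType) (u : R -> R) : Prop :=
  forall T : R, 0 <= T ->
    (@lebesgue_measure R).-integrable `[0, T] (fun t => (u t)%:E).

(* Caratheodory solution on [0, +oo[ of x1' = f1(x2), x2' = f2(x1,x2) + b u,
   x(0) = x0.  The values of x and u at negative times are irrelevant.  Since
   f1 and f2 are only continuous, solutions need not be unique. *)
Definition trajectory (R : realType) (f1 : R -> R) (f2 : R -> R -> R) (b : R)
    (u : R -> R) (x0 : R * R) (x : R -> R * R) : Prop :=
  {within `[0, +oo[, continuous x} /\
  forall t : R, 0 <= t ->
    (x t).1 = x0.1 + \int[lebesgue_measure]_(s in `[0, t]) f1 (x s).2 /\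
    (x t).2 = x0.2 + \int[lebesgue_measure]_(s in `[0, t])
                       (f2 (x s).1 (x s).2 + b * u s).

Definition admissible (R : realType) (f1 : R -> R) (f2 : R -> R -> R) (b : R)
    (x0 : R * R) (u : R -> R) (x : R -> R * R) : Prop :=
  allowable u /\ trajectory f1 f2 b u x0 x.

Definition closed_loop (R : realType) (f1 : R -> R) (f2 : R -> R -> R) (b : R)
    (phi : R -> R) (x0 : R * R) (x : R -> R * R) : Prop :=
  trajectory f1 f2 b (fun t => phi (x t).2) x0 x.

Definition lagrangian (R : realType) (Q : R -> R -> R) (r : R)
    (x1 x2 u : R) : R := Q x1 x2 + r * u ^+ 2.

Definition cost (R : realType) (Q : R -> R -> R) (r : R)
    (u : R -> R) (x : R -> R * R) : \bar R :=
  (\int[lebesgue_measure]_(t in `[0%R, +oo[)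
     (lagrangian Q r (x t).1 (x t).2 (u t))%:E)%E.

Definition value_function (R : realType) (f1 : R -> R) (f2 : R -> R -> R)
    (b : R) (Q : R -> R -> R) (r : R) (x0 : R * R) : \bar R :=
  ereal_inf [set c | exists (u : R -> R) (x : R -> R * R),
               admissible f1 f2 b x0 u x /\ c = cost Q r u x].

(* The feedback u = phi(x2) can be run from x0, and however the (possibly
   non-unique) closed-loop solution evolves, the input it generates is allowable
   and attains the infimum. *)
Definition optimal_feedback (R : realType) (f1 : R -> R) (f2 : R -> R -> R)
    (b : R) (Q : R -> R -> R) (r : R) (phi : R -> R) (x0 : R * R) : Prop :=
  (exists x, closed_loop f1 f2 b phi x0 x) /\
  forall x, closed_loop f1 f2 b phi x0 x ->
    allowable (fun t => phi (x t).2) /\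
    cost Q r (fun t => phi (x t).2) x = value_function f1 f2 b Q r x0.

(* Boundary condition at infinite time for the Hamilton-Jacobi-Bellman equation
   of the infinite-horizon problem.  The value function of a problem with
   nonnegative running cost tends to 0 along every solution of finite cost; an
   arbitrary C^1 solution W of the stationary equation with W(0) = 0 need not,
   and may then differ from the value function. *)
Definition terminal_condition (R : realType) (f1 : R -> R) (f2 : R -> R -> R)
    (b : R) (Q : R -> R -> R) (r : R) (phi : R -> R) (W : R * R -> R)
    (x0 : R * R) : Prop :=
  (forall x, closed_loop f1 f2 b phi x0 x -> W (x t) @[t --> +oo] --> (0 : R)) /\
  (forall u x, admissible f1 f2 b x0 u x -> (cost Q r u x < +oo)%E ->
     W (x t) @[t --> +oo] --> (0 : R)).

Definition positive_definite (R : realType) (W : R * R -> R) : Prop :=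
  W (0, 0) = 0 /\ forall p, p != (0, 0) -> 0 < W p.

Definition locally_positive_definite (R : realType) (W : R * R -> R) : Prop :=
  W (0, 0) = 0 /\
  exists2 N : set (R * R), nbhs ((0, 0) : R * R) N &
    forall p, N p -> p != (0, 0) -> 0 < W p.

Definition radially_unbounded (R : realType) (W : R * R -> R) : Prop :=
  forall M : R, exists A : R, forall p : R * R, A < `|p| -> M < W p.

Definition nonincreasing_along_closed_loop (R : realType) (f1 : R -> R)
    (f2 : R -> R -> R) (b : R) (phi : R -> R) (W : R * R -> R) : Prop :=
  forall x0 x, closed_loop f1 f2 b phi x0 x ->
    forall t : R, 0 < t ->
      derivable (fun s : R => W (x s)) t 1 /\
      derive1 (fun s : R => W (x s)) t <= 0.

Definition local_lyapunov (R : realType) (f1 : R -> R) (f2 : R -> R -> R)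
    (b : R) (phi : R -> R) (W : R * R -> R) : Prop :=
  locally_positive_definite W /\ nonincreasing_along_closed_loop f1 f2 b phi W.

Definition global_lyapunov (R : realType) (f1 : R -> R) (f2 : R -> R -> R)
    (b : R) (phi : R -> R) (W : R * R -> R) : Prop :=
  [/\ positive_definite W, radially_unbounded W &
      nonincreasing_along_closed_loop f1 f2 b phi W].

Definition closed_loop_minimizer (R : realType) (Q : R -> R -> R) (r : R)
    (phi : R -> R) (p : R * R) : Prop :=
  forall q : R * R, lagrangian Q r p.1 p.2 (phi p.2)
                    <= lagrangian Q r q.1 q.2 (phi q.2).

(* Main.v *)
(* Along any admissible pair, d/dt V(x) + Q + r u^2 = r (u - k f1(x2))^2.  If V
   tends to 0 along the solution, integrating gives cost >= V(x0), with equality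
   for the feedback.  Inputs are only integrable, so this identity rests on a
   chain rule for indefinite integrals.

   Under the monotonicity assumptions V is a sum of two potentials with strictly
   increasing derivatives, hence automatically coercive, and the sign condition
   forces f22(x1, 0) = 0.  V then tends to 0 along every solution of finite cost:
   V can only increase by what the running cost pays, and if V stayed above v > 0,
   the derivative of (k / b) x1 x2 would be bounded below by a positive constant
   minus a multiple of the running cost, making x1 x2 unbounded on a bounded
   trajectory.  The terminal condition is thus automatic.  Closed-loop solutions
   exist globally by Peano's theorem, since they cannot leave a sublevel set. *)
Require Import Defs.
From HB Require Import structures.
From mathcomp Require Import all_boot all_order all_algebra.
From mathcomp Require Import all_classical all_reals all_analysis.
From mathcomp Require Import measurable_realfun lra ring.
Import Order.TTheory GRing.Theory Num.Theory.
Import numFieldNormedType.Exports.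
Local Open Scope classical_set_scope.
Local Open Scope ring_scope.

Set Implicit Arguments.
Unset Strict Implicit.

(** * Indefinite integrals of locally integrable functions *)

(** [V] is a multiple of the Hamiltonian [integral_from0 f1 x2 - integral_from0 f21 x1] of the drift
    [x1' = f1(x2)], [x2' = f21(x1)]. Hence [f21] conserves [V], and only [f22] and the input can
    change it, at a rate [- w]. The obstacle is regularity: along an arbitrary admissible pair
    [V (x t)] need not be differentiable, and [r * u ^+ 2] need not even be locally integrable.
    Estimates are therefore stated for increments of indefinite integrals, and the running cost is
    integrated only after the total cost is known to be finite, or along the feedback, where it is
    continuous. The bound [|w| <= L] is two-sided. On a solution of finite cost it makes [V (x t)]
    of bounded variation, so that finding arbitrarily late instants with small [V] is enough for
    convergence to 0. *)

Lemma continuous_fcomp (T U W : topologicalType) (f : T -> U) (g : U -> W) :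
  continuous f -> continuous g -> continuous (fun t => g (f t)).
Proof. by move=> cf cg t; apply: continuous_comp; [exact: cf|exact: cg]. Qed.

Lemma continuous_fst (T U : topologicalType) : continuous (@fst T U).
Proof. by move=> p; exact: cvg_fst. Qed.

Lemma continuous_snd (T U : topologicalType) : continuous (@snd T U).
Proof. by move=> p; exact: cvg_snd. Qed.

(** Supremum argument on the points where [psi t <= psi a]: comparison on the left of the supremum
    puts it in the set, comparison on its right pushes the set past it unless it is [b]. Each point
    is compared only with its neighbours, never two neighbours with each other. *)
Lemma locally_nonincreasing (R : realType) (psi : R -> R) (a b : R) :
  a <= b ->
  (forall t, a <= t <= b -> \forall s \near t,
     (a <= s <= t -> psi t <= psi s) /\ (t <= s <= b -> psi s <= psi t)) ->
  psi b <= psi a.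
Proof.
move=> ab loc.
pose S := [set t | a <= t <= b /\ psi t <= psi a].
have Sa : S a by split; rewrite ?lexx.
have hS : has_sup S.
  by split; [exists a|exists b => t [/andP[]]].
pose c := sup S.
have ac : a <= c by apply: ub_le_sup => //; case: hS.
have cb : c <= b by apply: ge_sup; [exists a|move=> t [/andP[]]].
have /nbhs_ballP[e /= e0 locc] := loc c (introT andP (conj ac cb)).
have Sc : psi c <= psi a.
  have [s Ss cs] := sup_adherent e0 hS.
  have sc : s <= c by apply: ub_le_sup => //; case: hS.
  have [/andP[as_ sb] sa] := Ss.
  have [|+ _] := locc s.
    by rewrite /ball/= ger0_norm ?subr_ge0//; rewrite -/c in cs; lra.
  by move=> /(_ _); rewrite as_ sc => /(_ isT)/le_trans; apply.
move: cb; rewrite le_eqVlt => /predU1P[<-//|cb].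
pose d := Num.min b (c + e / 2).
have cd : c < d by rewrite lt_min cb/=; lra.
have db : d <= b by rewrite ge_min lexx.
have dce : d <= c + e / 2 by rewrite ge_min lexx orbT.
have [|_ +] := locc d.
  by rewrite /ball/= distrC ger0_norm ?subr_ge0 ?(ltW cd)//; lra.
rewrite (ltW cd) db => /(_ isT) dc.
have : d <= c.
  apply: ub_le_sup; first by case: hS.
  split; last exact: le_trans dc Sc.
  by rewrite db (le_trans ac (ltW cd)).
by rewrite leNgt cd.
Qed.

(** The division-free form of the difference quotient holds on a full neighbourhood, so it can be
    pulled back along a continuous [X] that may revisit the value [y]. *)
Lemma is_derive1P (R : realType) (F : R -> R) (y d : R) :
  is_derive y (1 : R) F d <->
  forall e : R, 0 < e -> \forall z \near y,
    `|F z - F y - d * (z - y)| <= e * `|z - y|.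
Proof.
split=> [dF e e0|H].
  have cv : h^-1 *: (F (h *: (1 : R) + y) - F y) @[h --> (0 : R)^'] --> d.
    by case: dF => dF <-; exact: dF.
  have /(cvgrPdist_le _ _).1 /(_ e e0) /nbhs_ballP[r /= r0 Hr] := cv.
  apply/nbhs_ballP; exists r => //= z yz.
  have [->|zy] := eqVneq z y; first by rewrite !subrr mulr0 subrr normr0 mulr0.
  have zy0 : z - y != 0 by rewrite subr_eq0.
  have /= := Hr (z - y).
  rewrite /ball/= sub0r normrN; move: yz; rewrite /ball/= (distrC y) => yz /(_ yz zy0).
  rewrite /GRing.scale/= mulr1 subrK.
  have -> : F z - F y - d * (z - y) = - (d - (z - y)^-1 * (F z - F y)) * (z - y).
    by field.
  by move=> hr; rewrite normrM normrN ler_wpM2r.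
have cv : h^-1 *: (F (h *: (1 : R) + y) - F y) @[h --> (0 : R)^'] --> d.
  apply/cvgrPdist_le => e e0.
  have /nbhs_ballP[r /= r0 Hr] := H e e0.
  apply/nbhs_ballP; exists r => //= h; rewrite /ball/= sub0r normrN => hr h0.
  have := Hr (h + y); rewrite /ball/= opprD addrCA subrr addr0 normrN addrK => /(_ hr).
  rewrite /GRing.scale/= mulr1 => hh.
  rewrite -(ler_pM2r (x := `|h|)) ?normr_gt0// -normrM -normrN.
  apply: le_trans hh; rewrite le_eqVlt; apply/predU1P; left; congr (`|_|).
  by field.
by apply: DeriveDef; [exact: cvgP cv|exact/cvg_lim].
Qed.

Section primitive.
Context {R : realType}.
Notation mu := (@lebesgue_measure R).
Implicit Types (f g h : R -> R).

Lemma continuous_allowable f : continuous f -> allowable f.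
Proof.
move=> cf T _; apply: continuous_compact_integrable.
  exact: segment_compact.
exact: continuous_subspaceT.
Qed.

Lemma eq_allowable f g :
  (forall t, 0 <= t -> f t = g t) -> allowable f -> allowable g.
Proof.
move=> fg af T T0; apply: eq_integrable (af T T0) => // t.
by rewrite inE/= in_itv/= => /andP[t0 _]; rewrite fg.
Qed.

Lemma allowableD f g :
  allowable f -> allowable g -> allowable (fun t => f t + g t).
Proof. by move=> af ag T T0; apply: integrableD (af T T0) (ag T T0). Qed.

Lemma allowableM f h :
  continuous h -> allowable f -> allowable (fun t => h t * f t).
Proof.
move=> ch af T T0.
have : mu.-integrable `[0, T] ((EFin \o h) \* (EFin \o f))%E.
  apply: integrableMr => //; last exact: af.
    exact: measurable_funS (continuous_measurable_fun _).
  have /compact_bounded[M [_ mrt]] : compact (h @` `[0, T]).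
    by apply: continuous_compact; [exact: continuous_subspaceT|exact: segment_compact].
  by exists M; split; rewrite ?num_real => // N MN x xT; apply: (mrt _ MN); exists x.
by apply: eq_integrable.
Qed.

Lemma allowableZ k f : allowable f -> allowable (fun t => k * f t).
Proof. exact/allowableM/cst_continuous. Qed.

Lemma allowable_norm f : allowable f -> allowable (fun t => `|f t|).
Proof. by move=> af T T0; exact: integrable_norm (af T T0). Qed.

(** For [t < 0] the interval is empty and the value is 0, hence the recurring side conditions
    [0 <= t]. *)
Definition primitive g (t : R) : R := \int[mu]_(s in `[0, t]) g s.

Lemma primitive0 g : primitive g 0 = 0.
Proof. by rewrite /primitive set_itv1 Rintegral_set1. Qed.

Lemma eq_primitive f g t : (forall s, 0 <= s <= t -> f s = g s) ->
  primitive f t = primitive g t.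
Proof.
by move=> fg; apply: eq_Rintegral => s; rewrite inE/= in_itv/=; exact: fg.
Qed.

Lemma primitiveD f g t : allowable f -> allowable g -> 0 <= t ->
  primitive (fun s => f s + g s) t = primitive f t + primitive g t.
Proof. by move=> af ag t0; rewrite /primitive RintegralD//; [exact: af|exact: ag]. Qed.

Lemma primitiveZ k f t : allowable f -> 0 <= t ->
  primitive (fun s => k * f s) t = k * primitive f t.
Proof. by move=> af t0; rewrite /primitive RintegralZl//; exact: af. Qed.

Lemma primitive_cst k t : 0 <= t -> primitive (fun=> k) t = k * t.
Proof.
move=> t0; rewrite /primitive Rintegral_cst//= lebesgue_measure_itv/= lte_fin.
by case: ltgtP t0 => // [t0 _|<- _]; rewrite /= ?subr0.
Qed.

Lemma primitiveB g s t : allowable g -> 0 <= s <= t ->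
  primitive g t - primitive g s = \int[mu]_(x in `]s, t]) g x.
Proof.
move=> ag /andP[s0 st]; rewrite /primitive Rintegral_itvB ?bnd_simp//.
exact: ag (le_trans s0 st).
Qed.

Lemma allowable_itv g s t : allowable g -> 0 <= s <= t ->
  mu.-integrable `]s, t] (EFin \o g).
Proof.
move=> ag /andP[s0 st]; apply: integrableS (ag t (le_trans s0 st)) => //.
by move=> x /=; rewrite !in_itv/= => /andP[sx ->]; rewrite (le_trans s0 (ltW sx)).
Qed.

Lemma le_primitiveB f g s t : allowable f -> allowable g -> 0 <= s <= t ->
  (forall x, s <= x <= t -> f x <= g x) ->
  primitive f t - primitive f s <= primitive g t - primitive g s.
Proof.
move=> af ag st fg; rewrite !primitiveB//; apply: le_Rintegral => //.
- exact: allowable_itv.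
- exact: allowable_itv.
- by move=> x /=; rewrite in_itv/= => /andP[sx xt]; apply: fg; rewrite ltW.
Qed.

Lemma le_norm_primitiveB e f g s t : allowable f -> allowable g ->
  0 <= s <= t -> (forall x, s <= x <= t -> `|f x| <= e * g x) ->
  `|primitive f t - primitive f s| <= e * (primitive g t - primitive g s).
Proof.
move=> af ag st fg; have /andP[s0 /(le_trans s0) t0] := st.
have := @le_primitiveB f (fun x => e * g x) s t af (allowableZ e ag) st.
have := @le_primitiveB (fun x => -1 * f x) (fun x => e * g x) s t
  (allowableZ _ af) (allowableZ e ag) st.
rewrite !primitiveZ// => Nh h.
rewrite ler_norml; apply/andP; split.
  suff : -1 * primitive f t - -1 * primitive f s <= e * primitive g t - e * primitive g s by lra.
  by apply: Nh => x /fg; rewrite mulN1r ler_norml => /andP[]; lra.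
suff : primitive f t - primitive f s <= e * primitive g t - e * primitive g s by lra.
by apply: h => x /fg /ler_normlP[].
Qed.

Lemma primitive_ge0 g t : (forall s, 0 <= s -> 0 <= g s) -> 0 <= primitive g t.
Proof.
by move=> g0; apply: Rintegral_ge0 => s/=; rewrite in_itv/= => /andP[/g0].
Qed.

(* The defect [F (X t) - int_0^t f(X) g] has local increments that are
   [o(int |g|)], so that no differentiation theorem is needed. *)
Lemma chain_rule (X g F f : R -> R) :
  allowable g -> continuous X ->
  (forall t, 0 <= t -> X t = X 0 + primitive g t) ->
  continuous f -> (forall y, is_derive y (1 : R) F (f y)) ->
  forall t, 0 <= t ->
  F (X t) = F (X 0) + primitive (fun s => f (X s) * g s) t.
Proof.
move=> ag cX Xg cf dF.
have cfX : continuous (f \o X) by move=> x; apply: continuous_comp; [exact: cX|exact: cf].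
have afXg : allowable (fun s => f (X s) * g s) by exact: allowableM cfX _.
pose P := primitive (fun s => f (X s) * g s).
pose G := primitive (fun s => `|g s|).
pose D t := F (X t) - P t.
have ang := allowable_norm ag.
(* One endpoint is frozen at [t] and the other lies on either side. Half of [e] pays for the
   linearization error of [F] at [X t], half for the oscillation of [f (X s)] near [t]. *)
have locD (e t : R) : 0 < e -> \forall s \near t,
    forall u v : R, 0 <= u <= v -> (u = t /\ v = s \/ u = s /\ v = t) ->
    `|D v - D u| <= e * (G v - G u).
  move=> e0; have e20 : 0 < e / 2 by rewrite divr_gt0.
  have XB (u v : R) : 0 <= u <= v -> `|X v - X u| <= G v - G u.
    move=> uv; have /andP[u0 /(le_trans u0) v0] := uv.
    rewrite (Xg v)// (Xg u)// opprD addrACA subrr add0r -[leRHS]mul1r.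
    by apply: le_norm_primitiveB => // x _; rewrite mul1r.
  have /(cvgrPdist_le _ _).1 /(_ _ e20) fXe := cfX t.
  have Fe : \forall y \near X t,
      `|F y - F (X t) - f (X t) * (y - X t)| <= e / 2 * `|y - X t|.
    exact: (is_derive1P F (X t) (f (X t))).1 (dF _) _ e20.
  have FXe : \forall s \near t,
      `|F (X s) - F (X t) - f (X t) * (X s - X t)| <= e / 2 * `|X s - X t|.
    exact: cX t _ Fe.
  have /nbhs_ballP[d /= d0 fXd] := fXe.
  near=> s => u v uv hs.
  have st : ball t d s by near: s; exact: nbhsx_ballx.
  have -> : D v - D u = (F (X v) - F (X u) - f (X t) * (X v - X u))
      - (P v - P u - f (X t) * (X v - X u)) by rewrite /D; ring.
  have H1 : `|F (X v) - F (X u) - f (X t) * (X v - X u)| <= e / 2 * (G v - G u).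
    apply: (@le_trans _ _ (e / 2 * `|X v - X u|)); last first.
      by rewrite ler_wpM2l ?XB// ltW.
    have Hs : `|F (X s) - F (X t) - f (X t) * (X s - X t)| <= e / 2 * `|X s - X t|.
      by near: s.
    case: hs => [] [-> ->] //.
    have -> : F (X t) - F (X s) - f (X t) * (X t - X s) =
        - (F (X s) - F (X t) - f (X t) * (X s - X t)) by ring.
    by rewrite normrN (distrC (X t)).
  have /andP[u0 uv'] := uv; have v0 := le_trans u0 uv'.
  have H2 : `|P v - P u - f (X t) * (X v - X u)| <= e / 2 * (G v - G u).
    have -> : P v - P u - f (X t) * (X v - X u) =
       primitive (fun s => (f (X s) - f (X t)) * g s) v -
       primitive (fun s => (f (X s) - f (X t)) * g s) u.
      have E (w : R) : 0 <= w -> primitive (fun s => (f (X s) - f (X t)) * g s) w =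
          P w - f (X t) * (X w - X 0).
        move=> w0; rewrite (Xg w)// addrAC subrr add0r.
        rewrite -[in RHS]mulNr -primitiveZ// -primitiveD//; last exact: allowableZ.
        by apply: eq_primitive => x _; ring.
      by rewrite !E//; ring.
    apply: le_norm_primitiveB => //.
      apply: (@allowableM g (fun s => f (X s) - f (X t))) => //.
      by move=> x; apply: cvgB; [exact: cfX|exact: cvg_cst].
    move=> x /andP[ux xv]; rewrite normrM ler_wpM2r// distrC.
    apply: fXd; rewrite /ball/=; move: st; rewrite /ball/= => st.
    apply: le_lt_trans st.
    case: hs ux xv => [] [-> ->] tx xs.
      by rewrite !(distrC t) !ger0_norm ?subr_ge0//; lra.
    by rewrite !ger0_norm ?subr_ge0//; lra.
  apply: le_trans (ler_normB _ _) _.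
  by rewrite (splitr e) mulrDl; exact: lerD.
suff DE (t : R) : 0 <= t -> `|D t - D 0| = 0.
  move=> t t0; have /normr0_eq0 := DE t t0.
  by rewrite /D /P primitive0 subr0; lra.
move=> t0.
have G0 : 0 <= G t by apply: primitive_ge0.
have H (e : R) : 0 < e -> `|D t - D 0| <= e * G t.
  move=> e0.
  (* The local bound makes both [D - e * G] and [- D - e * G] locally nonincreasing; together they
     bound the absolute value. *)
  have dec (sg : R) : sg = 1 \/ sg = -1 -> sg * D t - e * G t <= sg * D 0 - e * G 0.
    move=> sgE.
    apply: (@locally_nonincreasing _ (fun s => sg * D s - e * G s)) => //.
    move=> s /andP[s0 st]; near=> r.
    have hr : forall u v : R, 0 <= u <= v -> (u = s /\ v = r \/ u = r /\ v = s) ->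
        `|D v - D u| <= e * (G v - G u) by near: r; exact: locD.
    split=> /andP[h1 h2].
      have := hr r s; rewrite h1 h2 => /(_ isT (or_intror (conj erefl erefl))).
      by rewrite ler_norml => /andP[]; case: sgE => ->; lra.
    have := hr s r; rewrite s0 h1 => /(_ isT (or_introl (conj erefl erefl))).
    by rewrite ler_norml => /andP[]; case: sgE => ->; lra.
  have := dec 1 (or_introl erefl); have := dec (-1) (or_intror erefl).
  by rewrite /G primitive0 -/G ler_norml; lra.
apply/eqP; rewrite eq_le normr_ge0 andbT; apply/ler_addgt0Pl => e e0; rewrite addr0.
(* Dividing by [G t + 1] covers the case [G t = 0]. *)
have G1 : 0 < G t + 1 by lra.
apply: le_trans (H (e / (G t + 1)) _) _; first exact: divr_gt0.
by rewrite mulrAC ler_pdivrMr// ler_pM2l//; lra.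
Unshelve. all: by end_near. Qed.

End primitive.

(** Polarization: [2 X Y = (X + Y)^2 - X^2 - Y^2], with the chain rule for the square applied to
    each of the three terms. *)
Lemma product_rule (R : realType) (X Y g h : R -> R) :
  allowable g -> allowable h -> continuous X -> continuous Y ->
  (forall t, 0 <= t -> X t = X 0 + primitive g t) ->
  (forall t, 0 <= t -> Y t = Y 0 + primitive h t) ->
  forall t, 0 <= t ->
  X t * Y t = X 0 * Y 0 + primitive (fun s => Y s * g s + X s * h s) t.
Proof.
move=> ag ah cX cY Xg Yh t t0.
pose dbl (y : R) := 2 * y.
have cdbl : continuous dbl by move=> y; apply: cvgM; [exact: cvg_cst|exact: cvg_id].
have dsq (y : R) : is_derive y (1 : R) (fun y => y * y) (dbl y).
  apply/is_derive1P => e e0; apply/nbhs_ballP; exists e => //= z yz.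
  have -> : z * z - y * y - dbl y * (z - y) = (z - y) * (z - y) by rewrite /dbl; ring.
  by rewrite normrM ler_wpM2r// distrC ltW.
have cXY : continuous (fun s => X s + Y s) by move=> s; apply: cvgD; [exact: cX|exact: cY].
have EX := chain_rule ag cX Xg cdbl dsq t0.
have EY := chain_rule ah cY Yh cdbl dsq t0.
have XY s : 0 <= s -> X s + Y s = X 0 + Y 0 + primitive (fun s => g s + h s) s.
  by move=> s0; rewrite (Xg s)// (Yh s)// primitiveD//; ring.
have E := chain_rule (allowableD ag ah) cXY XY cdbl dsq t0.
have adX := fun f => @allowableM _ f _ (continuous_fcomp cX cdbl).
have adY := fun f => @allowableM _ f _ (continuous_fcomp cY cdbl).
have aXh : allowable (fun s => X s * h s) by exact: allowableM.
have aYg : allowable (fun s => Y s * g s) by exact: allowableM.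
move: E; rewrite (_ : primitive _ t = primitive (fun s => dbl (X s) * g s) t +
    primitive (fun s => dbl (Y s) * h s) t +
    2 * primitive (fun s => Y s * g s + X s * h s) t); last first.
  have aS := allowableD aYg aXh.
  have aX := adX g ag; have aY := adY h ah.
  rewrite -primitiveZ// -primitiveD// -primitiveD//; [|exact: allowableD|exact: allowableZ].
  by apply: eq_primitive => s _; rewrite /dbl; ring.
by move: EX EY; lra.
Qed.

(** * Integrals over the half-line as limits of integrals over bounded horizons *)

Section horizon.
Context {R : realType}.
Notation mu := (@lebesgue_measure R).
Implicit Types f : R -> R.

Lemma itv0y_bigcup :
  `[0, +oo[%classic = \bigcup_n `[0, n%:R]%classic :> set R.
Proof.
apply/seteqP; split=> [t|t [n _]] /=; rewrite !in_itv/= ?andbT; last by case/andP.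
move=> t0; exists (Num.truncn t).+1 => //=.
by rewrite in_itv/= t0 ltW//; exact: truncnS_gt.
Qed.

Lemma measurable_horizon f : (forall T : R, 0 <= T -> measurable_fun `[0, T] f) ->
  measurable_fun `[(0 : R), +oo[ f.
Proof. by move=> mf; rewrite itv0y_bigcup; apply/measurable_fun_bigcup => // n; exact: mf. Qed.

Lemma cvg_integral_horizon f :
  (forall t, 0 <= t -> 0 <= f t) -> measurable_fun `[(0 : R), +oo[ f ->
  (\int[mu]_(t in `[0%R, n%:R]) (f t)%:E)%E @[n --> \oo] -->
  (\int[mu]_(t in `[0%R, +oo[) (f t)%:E)%E.
Proof.
move=> f0 mf; rewrite itv0y_bigcup.
apply: (@ge0_nondecreasing_set_cvg_integral _ (measurableTypeR R) R (fun n => `[(0 : R), n%:R]%classic) (EFin \o f) mu).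
- move=> m n mn; apply/subsetPset => x /=; rewrite !in_itv/= => /andP[-> xm].
  by rewrite (le_trans xm)// ler_nat.
- by [].
- move=> n; apply/measurable_EFinP; apply: measurable_funS mf => //.
  by move=> x /=; rewrite !in_itv/= => /andP[->].
- by move=> n x /=; rewrite in_itv/= lee_fin => /andP[/f0].
Qed.

Lemma horizon_primitive f c :
  (forall t, 0 <= t -> 0 <= f t) -> allowable f ->
  primitive f t @[t --> +oo] --> c ->
  (\int[mu]_(t in `[0%R, +oo[) (f t)%:E)%E = c%:E.
Proof.
move=> f0 af fc.
have mf : measurable_fun `[(0 : R), +oo[ f.
  by apply: measurable_horizon => T T0; apply/measurable_EFinP; exact: measurable_int (af T T0).
apply: cvg_unique (cvg_integral_horizon f0 mf) _ => //.
have -> : (fun n => \int[mu]_(t in `[0%R, n%:R]) (f t)%:E)%E =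
          (fun n => (primitive f n%:R)%:E).
  apply/funext => n; rewrite /primitive /Rintegral fineK//.
  by apply: integrable_fin_num => //; exact: af.
apply: cvg_EFin; first by near=> n.
exact: (cvg_comp _ _ (@cvgr_idn R) fc).
Unshelve. all: by end_near. Qed.

(** Meant for the running cost: an integrable input may have a square that is not locally
    integrable, and finiteness of the total is what restores local integrability. *)
Lemma finite_horizon f :
  (forall t, 0 <= t -> 0 <= f t) -> measurable_fun `[(0 : R), +oo[ f ->
  (\int[mu]_(t in `[0%R, +oo[) (f t)%:E < +oo)%E ->
  allowable f /\ forall t, 0 <= t ->
    ((primitive f t)%:E <= \int[mu]_(t in `[0%R, +oo[) (f t)%:E)%E.
Proof.
move=> f0 mf foo.
have intf : mu.-integrable `[0, +oo[ (EFin \o f).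
  apply/integrableP; split; first exact/measurable_EFinP.
  suff <- : (\int[mu]_(t in `[0%R, +oo[) (f t)%:E =
             \int[mu]_(t in `[0%R, +oo[) `|(EFin \o f) t|)%E by [].
  apply: eq_integral => t; rewrite inE/= in_itv/= andbT => t0.
  by rewrite ger0_norm// f0.
have sub (T : R) : `[0, T] `<=` `[0, +oo[.
  by move=> x /=; rewrite !in_itv/= => /andP[->].
have af : allowable f by move=> T T0; exact: integrableS intf.
split=> // t t0; rewrite /primitive /Rintegral fineK; last first.
  by apply: integrable_fin_num => //; exact: af.
apply: ge0_subset_integral => //; first exact/measurable_EFinP.
by move=> x /=; rewrite in_itv/= andbT lee_fin => /f0.
Qed.

End horizon.

(** * The oriented integral as an antiderivative *)

Section integral_from0.
Context {R : realType} (f : R -> R).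
Hypothesis cf : continuous f.

Let int (a x : R) := \int[lebesgue_measure]_(s in `[a, x]) f s.

Let intf (a x : R) : (@lebesgue_measure R).-integrable `[a, x] (EFin \o f).
Proof.
by apply: continuous_compact_integrable; [exact: segment_compact|exact: continuous_subspaceT].
Qed.

(** A base point left of both 0 and [x] removes the case distinction on the sign of [x]. *)
Let integral_from0E (a x : R) : a <= 0 -> a <= x ->
  integral_from0 f x = int a x - int a 0.
Proof.
move=> a0 ax; rewrite /integral_from0 /int; case: leP => x0.
  rewrite Rintegral_itvB ?bnd_simp// Rintegral_itv_obnd_cbnd//.
  by apply: integrableS (intf 0 x) => //; apply: subset_itvr; rewrite bnd_simp.
rewrite -opprB Rintegral_itvB ?bnd_simp ?(ltW x0)// Rintegral_itv_obnd_cbnd//.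
by apply: integrableS (intf x 0) => //; apply: subset_itvr; rewrite bnd_simp.
Qed.

Lemma integral_from0_0 : integral_from0 f 0 = 0.
Proof. by rewrite /integral_from0 lexx set_itv1 Rintegral_set1. Qed.

Lemma is_derive_integral_from0 y : is_derive y (1 : R) (integral_from0 f) (f y).
Proof.
(* Strictly left of [y], as the fundamental theorem requires, and left of 0, as the base point
   formula requires. *)
pose a := Num.min y 0 - 1.
have ay : a < y by rewrite /a ltrBlDr gt_min ltrDl ltr01.
have a0 : a <= 0 by rewrite /a lerBlDr ge_min lerDl ler01 orbT.
have y1 : y < y + 1 by rewrite ltrDl.
have [dG GE] := continuous_FTC1_closed y1 (intf a (y + 1)) ay (@cf y).
apply/is_derive1P => e e0.
have dG' : is_derive y (1 : R) (int a) (f y).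
  by split; [exact: dG|rewrite -derive1E; exact: GE].
have := (is_derive1P _ _ _).1 dG' e e0.
apply: filter_app; near=> z.
rewrite (integral_from0E a0 (ltW ay)) (@integral_from0E a z)//.
  by rewrite opprB addrA subrK.
by apply: ltW; near: z; exact: lt_nbhsr.
Unshelve. all: by end_near. Qed.

End integral_from0.

(** * Energy identity and optimality under the terminal condition *)

(** Freezing the state at its initial value for negative times gives continuity on the whole line,
    and the integral equations see only nonnegative times. *)
Lemma trajectory_continuous (R : realType) (f1 : R -> R) (f2 : R -> R -> R)
    (b : R) (u : R -> R) (x0 : R * R) (x : R -> R * R) :
  trajectory f1 f2 b u x0 x ->
  let y t := x (Num.max 0 t) in
  continuous y /\ trajectory f1 f2 b u x0 y.
Proof.
move=> [cx tx] y; have yE t : 0 <= t -> y t = x t by rewrite /y => /max_idPr ->.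
have cy : continuous y.
  move=> t U /= Ux.
  have max0 : (`[0, +oo[%classic : set R) (Num.max 0 t).
    by rewrite /= in_itv/= le_max lexx.
  have cxt := (subspace_continuousP _ _).1 cx _ max0 U Ux.
  have cm : {for t, continuous ((fun=> 0 : R) \max id)}.
    have c0 : {for t, continuous ((fun=> 0) : R -> R)} by exact: cvg_cst.
    have c1 : {for t, continuous (@id R)} by exact: cvg_id.
    exact: (continuous_max c0 c1).
  have H : \forall s \near t, (`[0, +oo[%classic : set R) (Num.max 0 s) -> U (y s).
    exact: cm _ cxt.
  have : \forall s \near t, U (y s); last by [].
  by apply: filterS H => s; apply; rewrite /= in_itv/= le_max lexx.
split=> //; split; first exact: continuous_subspaceT.
move=> t t0; have [h1 h2] := tx t t0; rewrite yE//; split.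
  rewrite h1; congr (_ + _); apply: eq_Rintegral => s.
  by rewrite inE/= in_itv/= => /andP[s0 _]; rewrite yE.
rewrite h2; congr (_ + _); apply: eq_Rintegral => s.
by rewrite inE/= in_itv/= => /andP[s0 _]; rewrite yE.
Qed.

Section control.
Context {R : realType} (r b k : R) (f1 f21 : R -> R) (f22 f2 Q : R -> R -> R).
Context (V : R * R -> R).
Hypothesis r_gt0 : 0 < r.
Hypothesis b_neq0 : b != 0.
Hypothesis f2E : forall x1 x2, f2 x1 x2 = f21 x1 + f22 x1 x2.
Hypothesis f1_cont : continuous f1.
Hypothesis f21_cont : continuous f21.
Hypothesis f22_cont : continuous (fun p : R * R => f22 p.1 p.2).
Hypothesis QE : forall x1 x2, Q x1 x2 =
  r * k ^+ 2 * f1 x2 ^+ 2 + 2 * b^-1 * r * k * f1 x2 * f22 x1 x2.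
Hypothesis sign : forall x1 x2, 0 <= b^-1 * k * f1 x2 * f22 x1 x2.
Hypothesis VE : forall x1 x2, V (x1, x2) =
  - 2 * b^-1 * r * k * (integral_from0 f1 x2 - integral_from0 f21 x1).

(** The velocities are left arbitrary because the formula serves twice: for the control system, and
    for the rescaled field in the existence proof. *)
Lemma value_along (x : R -> R * R) (g1 g2 : R -> R) t :
  continuous x -> allowable g1 -> allowable g2 ->
  (forall t, 0 <= t -> (x t).1 = (x 0).1 + primitive g1 t /\
                       (x t).2 = (x 0).2 + primitive g2 t) ->
  0 <= t -> V (x t) = V (x 0) + primitive (fun s =>
    2 * r * (b^-1 * k) * (f21 (x s).1 * g1 s - f1 (x s).2 * g2 s)) t.
Proof.
move=> cx ag1 ag2 S t0.
have cx1 := continuous_fcomp cx (@continuous_fst _ _).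
have cx2 := continuous_fcomp cx (@continuous_snd _ _).
have E1 := @chain_rule _ (fun t => (x t).1) _ _ _ ag1 cx1
  (fun t t0 => (S t t0).1) f21_cont (is_derive_integral_from0 f21_cont) t t0.
have E2 := @chain_rule _ (fun t => (x t).2) _ _ _ ag2 cx2
  (fun t t0 => (S t t0).2) f1_cont (is_derive_integral_from0 f1_cont) t t0.
have VP p : V p = - 2 * b^-1 * r * k * (integral_from0 f1 p.2 - integral_from0 f21 p.1).
  by case: p => a c; rewrite VE.
rewrite !VP E1 E2.
have a1 := allowableM (continuous_fcomp cx1 f21_cont) ag1.
have a2 := allowableM (continuous_fcomp cx2 f1_cont) ag2.
pose c := 2 * r * (b^-1 * k).
rewrite (_ : primitive (fun s => 2 * r * _ * _) t =
    c * primitive (fun s => f21 (x s).1 * g1 s) t +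
    - c * primitive (fun s => f1 (x s).2 * g2 s) t); first by rewrite /c; ring.
have a1c := allowableZ c a1; have a2c := allowableZ (- c) a2.
rewrite -!primitiveZ// -primitiveD//.
by apply: eq_primitive => s _; rewrite /c; ring.
Qed.

(** Admissibility in normalized form: the state is continuous on the whole line and the initial
    state is read off as [x 0]. *)
Definition solution (u : R -> R) (x : R -> R * R) : Prop :=
  [/\ continuous x, allowable u & forall t, 0 <= t ->
    (x t).1 = (x 0).1 + primitive (fun s => f1 (x s).2) t /\
    (x t).2 = (x 0).2 + primitive (fun s => f2 (x s).1 (x s).2 + b * u s) t].

Lemma admissible_solution x0 u x : admissible f1 f2 b x0 u x ->
  exists y, [/\ solution u y, y 0 = x0 & forall t, 0 <= t -> y t = x t].
Proof.
move=> [au tx]; have [cy [_ ty]] := trajectory_continuous tx.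
exists (fun t => x (Num.max 0 t)).
have x0E : x (Num.max 0 0) = x0.
  have [/=] := ty 0 (lexx _); rewrite !set_itv1 !Rintegral_set1 !addr0.
  by case: (x _) x0 {tx ty} => a c [a' c'] /= -> ->.
split=> // [|t /max_idPr ->//]; split=> // t t0; rewrite x0E; exact: ty.
Qed.

Lemma trajectory_allowable (phi : R -> R) x0 x : continuous phi ->
  closed_loop f1 f2 b phi x0 x -> allowable (fun t => phi (x t).2).
Proof.
move=> cphi /trajectory_continuous[cy _].
apply: (@eq_allowable _ (fun t => phi (x (Num.max 0 t)).2)).
  by move=> t /max_idPr ->.
apply: continuous_allowable; apply: continuous_fcomp cphi.
exact: continuous_fcomp cy (@continuous_snd _ _).
Qed.

Lemma closed_loop_solution (phi : R -> R) x0 x : continuous phi ->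
  closed_loop f1 f2 b phi x0 x ->
  exists y, [/\ solution (fun t => phi (y t).2) y, y 0 = x0 &
    forall t, 0 <= t -> y t = x t].
Proof.
move=> cphi cl.
have [|y [[cy au sy] y0 yx]] := @admissible_solution x0 (fun t => phi (x t).2) x.
  by split=> //; exact: trajectory_allowable cl.
exists y; split=> //; split=> //.
  by apply: eq_allowable au => t t0; rewrite yx.
move=> t t0; have [-> ->] := sy t t0; split=> //; congr (_ + _).
by apply: eq_primitive => s /andP[s0 _]; rewrite yx.
Qed.

Section along_solution.
Variables (u : R -> R) (x : R -> R * R).
Hypothesis sol : solution u x.

Lemma sol_allowable : allowable u. Proof. by case: sol. Qed.

Lemma sol_cont : continuous x. Proof. by case: sol. Qed.

Lemma sol_cont1 : continuous (fun t => (x t).1).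
Proof. exact: continuous_fcomp sol_cont (@continuous_fst _ _). Qed.

Lemma sol_cont2 : continuous (fun t => (x t).2).
Proof. exact: continuous_fcomp sol_cont (@continuous_snd _ _). Qed.

Lemma sol_f1 : continuous (fun t => f1 (x t).2).
Proof. exact: continuous_fcomp sol_cont2 f1_cont. Qed.

Lemma sol_f21 : continuous (fun t => f21 (x t).1).
Proof. exact: continuous_fcomp sol_cont1 f21_cont. Qed.

Lemma sol_f22 : continuous (fun t => f22 (x t).1 (x t).2).
Proof. exact: continuous_fcomp sol_cont f22_cont. Qed.

Lemma sol_rhs2 : allowable (fun t => f2 (x t).1 (x t).2 + b * u t).
Proof.
apply: allowableD; last exact/allowableZ/sol_allowable.
apply: (@eq_allowable _ (fun t => f21 (x t).1 + f22 (x t).1 (x t).2)).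
  by move=> t _; rewrite f2E.
by apply: allowableD; apply: continuous_allowable; [exact: sol_f21|exact: sol_f22].
Qed.

Let w t := 2 * (b^-1 * k) * r * f1 (x t).2 * f22 (x t).1 (x t).2 +
  2 * r * k * f1 (x t).2 * u t.

Lemma allowable_dissipation : allowable w.
Proof.
apply: allowableD; last first.
  apply: (allowableM (h := fun t => 2 * r * k * f1 (x t).2)); last exact: sol_allowable.
  by move=> t; apply: cvgM; [exact: cvg_cst|exact: sol_f1].
apply: continuous_allowable => t; apply: cvgM; last exact: sol_f22.
by apply: cvgM; [exact: cvg_cst|exact: sol_f1].
Qed.

(** The two products of [f1] and [f21], one from each state equation, cancel; what is left is
    [- w]. *)
Lemma energy_identity t : 0 <= t -> V (x t) = V (x 0) - primitive w t.
Proof.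
move=> t0; case: (sol) => _ _ S.
rewrite (value_along sol_cont (continuous_allowable sol_f1) sol_rhs2 S t0).
rewrite -[in RHS](mulN1r (primitive _ _)) -primitiveZ//; last exact: allowable_dissipation.
by congr (_ + _); apply: eq_primitive => s _; rewrite /w f2E; field.
Qed.

Let L t := lagrangian Q r (x t).1 (x t).2 (u t).

(** The cross term is nonnegative by [sign]. The remaining squares let errors in [u] and in
    [f1 (x t).2] be charged separately to the running cost. *)
Lemma lagrangian_lbound t : r * (k ^+ 2 * f1 (x t).2 ^+ 2 + u t ^+ 2) <= L t.
Proof.
rewrite /L /lagrangian QE mulrDr !mulrA -[leLHS]addr0 addrAC lerD2r lerD2l.
have := sign (x t).1 (x t).2; rewrite -(pmulr_rge0 _ r_gt0) => h.
by rewrite (_ : _ * _ = 2 * (r * (b^-1 * k * f1 (x t).2 * f22 (x t).1 (x t).2)));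
  [rewrite mulr_ge0|ring].
Qed.

Lemma lagrangian_ge0 t : 0 <= L t.
Proof.
apply: le_trans (lagrangian_lbound t).
by rewrite mulr_ge0 ?(ltW r_gt0)// addr_ge0// -?exprMn sqr_ge0.
Qed.

(** [L - w] is [r (u - k f1)^2], and [L + w] is [r (u + k f1)^2] plus four times the nonnegative
    term [r b^-1 k f1 f22]. *)
Lemma dissipation_le t : `|w t| <= L t.
Proof.
have h : 0 <= r * (b^-1 * k * f1 (x t).2 * f22 (x t).1 (x t).2).
  by rewrite mulr_ge0// ltW.
have s1 : 0 <= r * (u t - k * f1 (x t).2) ^+ 2 by rewrite mulr_ge0 ?sqr_ge0// ltW.
have s2 : 0 <= r * (u t + k * f1 (x t).2) ^+ 2 by rewrite mulr_ge0 ?sqr_ge0// ltW.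
rewrite ler_norml /L /w /lagrangian QE; apply/andP; split; nra.
Qed.

Lemma measurable_lagrangian : measurable_fun `[(0 : R), +oo[ L.
Proof.
apply: measurable_horizon => T T0; apply: measurable_funD.
  rewrite (_ : (fun _ => _) = (fun t => r * k ^+ 2 * f1 (x t).2 ^+ 2 +
     2 * b^-1 * r * k * f1 (x t).2 * f22 (x t).1 (x t).2)); last first.
    by apply/funext => t; rewrite QE.
  apply: measurable_funTS; apply: continuous_measurable_fun => t.
  apply: cvgD.
    apply: cvgM; first exact: cvg_cst.
    by apply: cvgM; exact: sol_f1.
  by apply: cvgM; [apply: cvgM; [exact: cvg_cst|exact: sol_f1]|exact: sol_f22].
apply: measurable_funM => //; apply: measurable_funX.
by apply/measurable_EFinP; exact: measurable_int (sol_allowable T0).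
Qed.

Lemma energy_variation s t : allowable L -> 0 <= s <= t ->
  `|V (x t) - V (x s)| <= primitive L t - primitive L s.
Proof.
move=> aL st; have /andP[s0 s_t] := st; have t0 := le_trans s0 s_t.
have -> : V (x t) - V (x s) = - (primitive w t - primitive w s).
  rewrite (energy_identity t0) (energy_identity s0).
  by move: (V _) (primitive w t) (primitive w s) => v p q; ring.
rewrite normrN -[leRHS]mul1r; apply: le_norm_primitiveB => //.
  exact: allowable_dissipation.
by move=> z _; rewrite mul1r dissipation_le.
Qed.

Lemma finite_cost_lagrangian : (cost Q r u x < +oo)%E ->
  allowable L /\ forall t, 0 <= t -> ((primitive L t)%:E <= cost Q r u x)%E.
Proof.
move=> foo; apply: finite_horizon => //; last exact: measurable_lagrangian.
by move=> t _; exact: lagrangian_ge0.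
Qed.

(** Infinite cost is trivial. Otherwise [V (x 0) - V (x t)] is at most the cost spent up to [t], and
    [t] tends to infinity. *)
Lemma value_le_cost : ((cost Q r u x < +oo)%E -> V (x t) @[t --> +oo] --> (0 : R)) ->
  ((V (x 0))%:E <= cost Q r u x)%E.
Proof.
move=> V0; have [coo|] := ltP (cost Q r u x) +oo%E; last first.
  by rewrite leye_eq => /eqP ->; rewrite leey.
have [aL Lc] := finite_cost_lagrangian coo.
have c0 : (0 <= cost Q r u x)%E by apply: integral_ge0 => t _; rewrite lee_fin lagrangian_ge0.
have cE : cost Q r u x = (fine (cost Q r u x))%:E by rewrite fineK// ge0_fin_numE.
rewrite cE lee_fin.
have Vlim : V (x 0) - V (x t) @[t --> +oo] --> V (x 0).
  by rewrite -[X in _ --> X]subr0; apply: cvgB; [exact: cvg_cst|exact: V0].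
apply: (cvgr_to_le Vlim); near=> t.
have t0 : 0 <= t by near: t; exact: nbhs_pinfty_ge.
have := @energy_variation 0 t aL; rewrite lexx t0 primitive0 subr0 => /(_ isT).
have := Lc t t0; rewrite cE lee_fin ler_norml => h /andP[]; lra.
Unshelve. all: by end_near. Qed.

End along_solution.

Lemma closed_loop_energy x t : solution (fun t => k * f1 (x t).2) x -> 0 <= t ->
  V (x t) = V (x 0) -
    primitive (fun s => lagrangian Q r (x s).1 (x s).2 (k * f1 (x s).2)) t.
Proof.
move=> sol t0; rewrite (energy_identity sol t0); congr (_ - _).
by apply: eq_primitive => s _; rewrite /lagrangian QE; ring.
Qed.

(** The feedback input is continuous in time, so the running cost is locally integrable before its
    total is known to be finite. *)
Lemma continuous_closed_loop_lagrangian x : solution (fun t => k * f1 (x t).2) x ->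
  continuous (fun s => lagrangian Q r (x s).1 (x s).2 (k * f1 (x s).2)).
Proof.
move=> sol.
rewrite (_ : (fun s => _) = (fun s => 2 * r * k ^+ 2 * (f1 (x s).2 * f1 (x s).2) +
    2 * b^-1 * r * k * (f1 (x s).2 * f22 (x s).1 (x s).2))); last first.
  by apply/funext => s; rewrite /lagrangian QE; ring.
move=> s; apply: cvgD; (apply: cvgM; first exact: cvg_cst).
  by apply: cvgM; exact: (sol_f1 sol).
by apply: cvgM; [exact: (sol_f1 sol)|exact: (sol_f22 sol)].
Qed.

Lemma closed_loop_cost x : solution (fun t => k * f1 (x t).2) x ->
  V (x t) @[t --> +oo] --> (0 : R) ->
  cost Q r (fun t => k * f1 (x t).2) x = (V (x 0))%:E.
Proof.
move=> sol V0; apply: horizon_primitive.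
- by move=> t _; exact: (lagrangian_ge0 (fun t => k * f1 (x t).2) x).
- exact/continuous_allowable/continuous_closed_loop_lagrangian.
have Vlim : V (x 0) - V (x t) @[t --> +oo] --> V (x 0).
  by rewrite -[X in _ --> X]subr0; apply: cvgB; [exact: cvg_cst|exact: V0].
apply: cvg_trans Vlim; apply: near_eq_cvg; near=> t.
have t0 : 0 <= t by near: t; exact: nbhs_pinfty_ge.
by rewrite (closed_loop_energy sol t0); ring.
Unshelve. all: by end_near. Qed.

Lemma cvg_eq_nneg (T : topologicalType) (f g : R -> T) (l : T) :
  (forall t, 0 <= t -> f t = g t) ->
  f t @[t --> +oo] --> l -> g t @[t --> +oo] --> l.
Proof.
move=> fg fl; apply: cvg_trans fl; apply: near_eq_cvg; near=> t.
by apply: fg; near: t; exact: nbhs_pinfty_ge.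
Unshelve. all: by end_near. Qed.

Lemma eq_cost u v x y : (forall t, 0 <= t -> u t = v t) ->
  (forall t, 0 <= t -> x t = y t) -> cost Q r u x = cost Q r v y.
Proof.
move=> uv xy; apply: eq_integral => t; rewrite inE/= in_itv/= andbT => t0.
by rewrite uv// xy.
Qed.

Lemma optimal_feedback_of_terminal_condition (u2 : R -> R) (x0 : R * R) :
  (forall x2, u2 x2 = k * f1 x2) ->
  (exists x, closed_loop f1 f2 b u2 x0 x) ->
  terminal_condition f1 f2 b Q r u2 V x0 ->
  optimal_feedback f1 f2 b Q r u2 x0 /\
  value_function f1 f2 b Q r x0 = (V x0)%:E.
Proof.
move=> u2E; have -> : u2 = (fun x2 => k * f1 x2) by exact/funext.
set phi := fun x2 => k * f1 x2.
have cphi : continuous phi.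
  by move=> y; apply: cvgM; [exact: cvg_cst|exact: f1_cont].
move=> ex [Vcl Vadm].
have clcost x : closed_loop f1 f2 b phi x0 x ->
    cost Q r (fun t => phi (x t).2) x = (V x0)%:E.
  move=> cl; have [y [sy y0 yx]] := closed_loop_solution cphi cl.
  rewrite -y0 -(closed_loop_cost sy).
    by apply: eq_cost => t t0; rewrite ?yx.
  by apply: cvg_eq_nneg (Vcl _ cl) => t t0; rewrite yx.
have val : value_function f1 f2 b Q r x0 = (V x0)%:E.
  apply/eqP; rewrite eq_le; apply/andP; split.
    have [x cl] := ex; apply: ereal_inf_lbound.
    exists (fun t => phi (x t).2), x; rewrite clcost//; split=> //.
    by split=> //; exact: trajectory_allowable cl.
  apply: le_ereal_inf_tmp => _ [u [x [adm ->]]].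
  have [y [sy y0 yx]] := admissible_solution adm.
  rewrite -y0 (@eq_cost u u x y)//; last by move=> t t0; rewrite yx.
  apply: (value_le_cost sy) => coo.
  apply: cvg_eq_nneg (Vadm _ _ adm _) => [t t0|]; first by rewrite yx.
  by rewrite (@eq_cost u u x y)// => t t0; rewrite yx.
by split=> //; split=> // x cl; split; [exact: trajectory_allowable cl|rewrite val clcost].
Qed.

End control.

(** * Coercive potentials *)

Section potential.
Context {R : realType} (G g : R -> R).
Hypothesis dG : forall y, is_derive y (1 : R) G (g y).
Hypothesis g_incr : {homo g : x y / x < y}.
Hypothesis g0 : g 0 = 0.
Hypothesis G0 : G 0 = 0.

Lemma potential_continuous : continuous G.
Proof.
by move=> y; apply: differentiable_continuous; apply/derivable1_diffP; case: (dG y).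
Qed.

Lemma potential_mvt x y : x < y -> exists2 c, x < c < y & G y - G x = g c * (y - x).
Proof.
move=> xy; have [|c cxy E] := @MVT _ G g _ _ xy (fun z _ => dG z).
  exact/continuous_subspaceT/potential_continuous.
by exists c; rewrite // -in_itv.
Qed.

Lemma potential_lt_right x y : 0 <= x -> x < y -> G x < G y.
Proof.
move=> x0 xy; have [c /andP[xc cy] E] := potential_mvt xy.
have c0 : 0 < g c by rewrite -g0 g_incr// (le_lt_trans x0).
by rewrite -subr_gt0 E mulr_gt0// subr_gt0.
Qed.

Lemma potential_lt_left x y : y <= 0 -> x < y -> G y < G x.
Proof.
move=> y0 xy; have [c /andP[xc cy] E] := potential_mvt xy.
have c0 : g c < 0 by rewrite -g0 g_incr// (lt_le_trans cy).
by rewrite -subr_lt0 E pmulr_llt0// subr_gt0.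
Qed.

Lemma potential_gt0 x : x != 0 -> 0 < G x.
Proof.
case: (ltgtP x 0) => // x0 _.
  by rewrite -G0; exact: potential_lt_left.
by rewrite -G0; exact: potential_lt_right.
Qed.

Lemma potential_ge0 x : 0 <= G x.
Proof. by have [->|/potential_gt0/ltW//] := eqVneq x 0; rewrite G0. Qed.

(** [G] is strictly monotone on each half-line, so the smaller of its values at [e] and [- e] is a
    threshold. *)
Lemma potential_small e : 0 < e -> exists2 m, 0 < m & forall x, G x < m -> `|x| < e.
Proof.
move=> e0; exists (Num.min (G e) (G (- e))).
  by rewrite lt_min !potential_gt0// ?oppr_eq0 gt_eqF.
move=> x; rewrite lt_min => /andP[xe xNe]; rewrite ltr_norml; apply/andP; split.
  rewrite ltNge; apply/negP; rewrite le_eqVlt => /predU1P[xE|xlt].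
    by rewrite xE ltxx in xNe.
  have := @potential_lt_left x (- e); rewrite oppr_le0 (ltW e0) => /(_ isT xlt).
  by rewrite ltNge (ltW xNe).
rewrite ltNge; apply/negP; rewrite le_eqVlt => /predU1P[xE|xlt].
  by rewrite -xE ltxx in xe.
have := @potential_lt_right e x (ltW e0) xlt.
by rewrite ltNge (ltW xe).
Qed.

(** Beyond [-1] and [1] the slope has absolute value at least [m], so [G x] is at least
    [m (|x| - 1)]. *)
Lemma potential_coercive M : exists A, forall x, A < `|x| -> M < G x.
Proof.
have g1 : 0 < g 1 by rewrite -[X in X < _]g0 g_incr.
have gN1 : g (-1) < 0 by rewrite -[X in _ < X]g0 g_incr// oppr_lt0.
pose m := Num.min (g 1) (- g (-1)).
have m0 : 0 < m by rewrite lt_min g1 oppr_gt0.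
have m1 : m <= g 1 by rewrite ge_min lexx.
have mN1 : m <= - g (-1) by rewrite ge_min lexx orbT.
(* Solves [m (|x| - 1) > M]; the absolute value of [M] keeps the threshold at least 1. *)
exists (1 + `|M| / m) => x.
have Mm0 : 0 <= `|M| / m by rewrite divr_ge0// ltW.
have key (y : R) : `|M| / m < y -> M < m * y.
  by rewrite ltr_pdivrMr// (mulrC y); apply: le_lt_trans; exact: ler_norm.
have [x0|x0] := leP 0 x.
  rewrite (ger0_norm x0) => Ax; have x1 : 1 < x by lra.
  have [c /andP[c1 cx] E] := potential_mvt x1.
  have G1 := potential_ge0 1; have gc := g_incr c1.
  have Mx : M < m * (x - 1) by apply: key; lra.
  have : m * (x - 1) <= g c * (x - 1) by rewrite ler_wpM2r//; lra.
  by move: E; lra.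
rewrite (ltr0_norm x0) => Ax; have x1 : x < -1 by lra.
have [c /andP[c1 cx] E] := potential_mvt x1.
have G1 := potential_ge0 (-1); have gc := g_incr cx.
have Mx : M < m * (-1 - x) by apply: key; lra.
have : m * (-1 - x) <= - g c * (-1 - x) by rewrite ler_wpM2r//; lra.
by move: E; lra.
Qed.

End potential.

(** The derivative may vanish at 0, so the mean value theorem is applied on each half-line and the
    two parts are glued at 0. *)
Lemma derive_gt0_incr (R : realType) (g : R -> R) :
  (forall s, derivable g s 1) -> (forall x, x != 0 -> 0 < derive1 g x) ->
  {homo g : x y / x < y}.
Proof.
move=> dg g'0.
have cg : continuous g.
  by move=> y; apply: differentiable_continuous; apply/derivable1_diffP; exact: dg.
have dg1 (y : R) : is_derive y (1 : R) g (derive1 g y).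
  by apply: DeriveDef; [exact: dg|rewrite derive1E].
have side (x y : R) : x < y -> (0 <= x) || (y <= 0) -> g x < g y.
  move=> xy xy0.
  have [|c cxy E] := @MVT _ g (derive1 g) _ _ xy (fun z _ => dg1 z).
    exact: continuous_subspaceT.
  move: cxy; rewrite in_itv/= => /andP[xc cy].
  rewrite -subr_gt0 E mulr_gt0 ?subr_gt0// g'0//.
  by case/orP: xy0 => ?; [rewrite gt_eqF//|rewrite lt_eqF//]; lra.
move=> x y xy; have [x0|x0] := leP 0 x; first by rewrite side// x0.
have [y0|y0] := leP y 0; first by rewrite side// y0 orbT.
by apply: (@lt_trans _ _ (g 0)); rewrite side ?lexx ?orbT.
Qed.

(** A penalty argument: a large multiple of [h] repairs [g] away from the zeros of [h], and near
    those zeros [g] is already positive. The same [n] serves as multiplier and, inverted, as lower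
    bound, so compactness needs a single parameter. *)
Lemma compact_combination_gt0 (R : realType) (T : topologicalType) (K : set T)
    (g h : T -> R) : compact K -> continuous g -> continuous h ->
  (forall p, 0 <= h p) -> (forall p, K p -> h p = 0 -> 0 < g p) ->
  exists n : nat, forall p, K p -> n.+1%:R^-1 <= g p + n%:R * h p.
Proof.
move=> cK cg ch h0 gh.
have [n _ Hn] : \forall n \near \oo, K `<=` [set p | n.+1%:R^-1 <= g p + n%:R * h p].
  apply: (compact_near_coveringP K).1 => // p Kp.
  have [hp0|hp0] := eqVneq (h p) 0.
    have gp := gh p Kp hp0.
    have gp2 : g p / 2 < g p by lra.
    near=> q n => /=.
    have gq : g p / 2 < g q by near: q; exact: (cvgr_gt (g p) (cg p)).
    have hq : 0 <= n%:R * h q by rewrite mulr_ge0.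
    rewrite -[leLHS]addr0 lerD//; apply: le_trans (ltW gq).
    rewrite -[leRHS]invrK lef_pV2 ?posrE ?invr_gt0//; last lra.
    apply: (@le_trans _ _ n%:R); last by rewrite ler_nat.
    by near: n; exact: nbhs_infty_ger.
  have hp : 0 < h p by rewrite lt_neqAle eq_sym hp0 h0.
  near=> q n => /=.
  have gq : g p - 1 < g q by near: q; apply: (cvgr_gt (g p) (cg p)); lra.
  have hq : h p / 2 < h q by near: q; apply: (cvgr_gt (h p) (ch p)); lra.
  (* Of the 2, one unit absorbs [g p - 1 < g q] and the other bounds [n.+1%:R^-1]. *)
  have nn : (2 + `|g p|) / (h p / 2) <= n%:R by near: n; exact: nbhs_infty_ger.
  have h2 : 0 < h p / 2 by lra.
  have n1 : n.+1%:R^-1 <= 1 :> R by rewrite invf_le1// ler1n.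
  have : 2 + `|g p| <= n%:R * h q.
    apply: (@le_trans _ _ (n%:R * (h p / 2))); first by rewrite -ler_pdivrMr.
    by rewrite ler_wpM2l// ltW.
  by move=> nh; apply: (le_trans n1); have := ler_norm (- g p); rewrite normrN; lra.
by exists n; exact: Hn (leqnn n).
Unshelve. all: by end_near. Qed.

(** * Convergence of finite-cost solutions *)

Section stability.
Context {R : realType} (r b k : R) (f1 f21 : R -> R) (f22 f2 Q : R -> R -> R).
Context (V : R * R -> R).
Hypothesis r_gt0 : 0 < r.
Hypothesis b_neq0 : b != 0.
Hypothesis k_neq0 : k != 0.
Hypothesis f2E : forall x1 x2, f2 x1 x2 = f21 x1 + f22 x1 x2.
Hypothesis f1_cont : continuous f1.
Hypothesis f21_cont : continuous f21.
Hypothesis f22_cont : continuous (fun p : R * R => f22 p.1 p.2).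
Hypothesis QE : forall x1 x2, Q x1 x2 =
  r * k ^+ 2 * f1 x2 ^+ 2 + 2 * b^-1 * r * k * f1 x2 * f22 x1 x2.
Hypothesis sign : forall x1 x2, 0 <= b^-1 * k * f1 x2 * f22 x1 x2.
Hypothesis VE : forall x1 x2, V (x1, x2) =
  - 2 * b^-1 * r * k * (integral_from0 f1 x2 - integral_from0 f21 x1).
Hypothesis f1_0 : f1 0 = 0.
Hypothesis f21_0 : f21 0 = 0.

(** The signs are chosen so that both slopes increase; [V] is then [2 * r] times the sum of the
    potentials [A1] and [A2]. *)
Let a1 y := b^-1 * k * f21 y.
Let a2 y := - (b^-1 * k) * f1 y.
Hypothesis a1_incr : {homo a1 : x y / x < y}.
Hypothesis a2_incr : {homo a2 : x y / x < y}.

Let A1 y := b^-1 * k * integral_from0 f21 y.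
Let A2 y := - (b^-1 * k) * integral_from0 f1 y.

Let dA1 y : is_derive y (1 : R) A1 (a1 y).
Proof. by have := is_derive_integral_from0 f21_cont y => ?; exact: is_deriveZ. Qed.

Let dA2 y : is_derive y (1 : R) A2 (a2 y).
Proof. by have := is_derive_integral_from0 f1_cont y => ?; exact: is_deriveZ. Qed.

Let a10 : a1 0 = 0. Proof. by rewrite /a1 f21_0 mulr0. Qed.
Let a20 : a2 0 = 0. Proof. by rewrite /a2 f1_0 mulr0. Qed.
Let A10 : A1 0 = 0. Proof. by rewrite /A1 integral_from0_0 mulr0. Qed.
Let A20 : A2 0 = 0. Proof. by rewrite /A2 integral_from0_0 mulr0. Qed.

Let VA p : V p = 2 * r * (A1 p.1 + A2 p.2).
Proof. by case: p => x y; rewrite VE /A1 /A2; ring. Qed.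

Let A1_ge0 := potential_ge0 dA1 a1_incr a10 A10.
Let A2_ge0 := potential_ge0 dA2 a2_incr a20 A20.

Lemma value_ge0 p : 0 <= V p.
Proof. by rewrite VA mulr_ge0 ?addr_ge0// mulr_ge0// ltW. Qed.

Lemma value_positive_definite : positive_definite V.
Proof.
split=> [|[x y] xy0]; first by rewrite VA A10 A20 addr0 mulr0.
rewrite VA mulr_gt0 ?mulr_gt0//=.
have [x0|x0] := eqVneq x 0; last first.
  by apply: ltr_pwDl => //; exact: (potential_gt0 dA1 a1_incr a10 A10 x0).
have y0 : y != 0 by apply: contra_neq xy0 => ->; rewrite x0.
by apply: ltr_wpDl => //; exact: (potential_gt0 dA2 a2_incr a20 A20 y0).
Qed.

Lemma value_continuous : continuous V.
Proof.
rewrite (_ : V = fun p => 2 * r * (A1 p.1 + A2 p.2)); last exact/funext.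
move=> p; apply: cvgM; first exact: cvg_cst.
apply: cvgD.
  exact: (continuous_fcomp (@continuous_fst _ _) (potential_continuous dA1)).
exact: (continuous_fcomp (@continuous_snd _ _) (potential_continuous dA2)).
Qed.

(** Converts decay of [V] into convergence of the state. The norm on pairs is the maximum norm, so
    each coordinate is handled by its own potential. *)
Lemma value_small e : 0 < e -> exists2 m, 0 < m & forall p, V p < m -> `|p| < e.
Proof.
move=> e0.
have [m1 m10 h1] := potential_small dA1 a1_incr a10 A10 e0.
have [m2 m20 h2] := potential_small dA2 a2_incr a20 A20 e0.
have r2 : 0 < 2 * r by rewrite mulr_gt0.
exists (2 * r * Num.min m1 m2); first by rewrite mulr_gt0// lt_min m10.
move=> p; rewrite VA ltr_pM2l// lt_min => /andP[pm1 pm2].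
rewrite prod_normE gt_max; apply/andP; split.
  by apply: h1; apply: le_lt_trans pm1; rewrite lerDl.
by apply: h2; apply: le_lt_trans pm2; rewrite lerDr.
Qed.

Lemma value_radially_unbounded : radially_unbounded V.
Proof.
move=> M; have r2 : 0 < 2 * r by rewrite mulr_gt0.
have [B1 h1] := potential_coercive dA1 a1_incr a10 A10 (M / (2 * r)).
have [B2 h2] := potential_coercive dA2 a2_incr a20 A20 (M / (2 * r)).
exists (Num.max B1 B2) => p; rewrite prod_normE lt_max !gt_max.
rewrite VA mulrC -ltr_pdivrMr// => /orP[] /andP[? ?].
  by apply: lt_le_trans (h1 p.1 _) _ => //; rewrite lerDl.
by apply: lt_le_trans (h2 p.2 _) _ => //; rewrite lerDr.
Qed.

(** [f1] changes sign strictly at 0, so [sign] forces weakly opposite signs of [f22 x] on the two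
    sides, and continuity leaves only 0. *)
Lemma f22_axis x : f22 x 0 = 0.
Proof.
have cf : continuous (f22 x).
  have cp : continuous (fun y : R => (x, y)).
    by move=> y; apply: (@cvg_pair _ _ _ _ (nbhs x) (nbhs y)); [exact: cvg_cst|exact: cvg_id].
  exact: continuous_fcomp cp f22_cont.
have side (y : R) : 0 <= (a2 y) * (- f22 x y).
  have -> : a2 y * - f22 x y = b^-1 * k * f1 y * f22 x y by rewrite /a2; ring.
  exact: sign.
apply/eqP; rewrite eq_le; apply/andP; split; rewrite leNgt; apply/negP => f0.
  have /nbhs_ballP[e /= e0 He] : \forall y \near (0 : R), 0 < f22 x y.
    exact: (cvgr_gt (f22 x 0) (cf 0)).
  have := He (e / 2); rewrite /ball/= sub0r normrN gtr0_norm ?divr_gt0//.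
  rewrite ltr_pdivrMr// ltr_pMr// ltr1n => /(_ isT) fe.
  have := side (e / 2); have := @a2_incr 0 (e / 2); rewrite divr_gt0// a20 => /(_ isT) ae.
  by rewrite pmulr_rge0// oppr_ge0 leNgt fe.
have /nbhs_ballP[e /= e0 He] : \forall y \near (0 : R), f22 x y < 0.
  exact: (cvgr_lt (f22 x 0) (cf 0)).
have := He (- (e / 2)); rewrite /ball/= sub0r opprK gtr0_norm ?divr_gt0//.
rewrite ltr_pdivrMr// ltr_pMr// ltr1n => /(_ isT) fe.
have := side (- (e / 2)); have := @a2_incr (- (e / 2)) 0; rewrite oppr_lt0 divr_gt0// a20 => /(_ isT) ae.
by rewrite nmulr_rge0// oppr_le0 leNgt fe.
Qed.

Section decay.
Variables (u : R -> R) (x : R -> R * R) (M : R).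
Hypothesis sol : solution b f1 f2 u x.
Let L t := lagrangian Q r (x t).1 (x t).2 (u t).
Hypothesis aL : allowable L.
Hypothesis LM : forall t, 0 <= t -> primitive L t <= M.

Let variation s t := @energy_variation _ _ _ _ _ _ _ _ _ _
  r_gt0 b_neq0 f2E f1_cont f21_cont f22_cont QE sign VE _ _ sol s t aL.

Let cost_le s t : 0 <= s <= t -> primitive L s <= primitive L t.
Proof. by move=> /variation /(le_trans (normr_ge0 _)); rewrite subr_ge0. Qed.

Let value_le s t : 0 <= s <= t -> V (x t) <= V (x s) + (primitive L t - primitive L s).
Proof. by move=> /variation; rewrite ler_norml => /andP[_]; rewrite lerBlDl. Qed.

Let cost_ge0 t : 0 <= t -> 0 <= primitive L t.
Proof. by move=> t0; rewrite -(primitive0 L) cost_le// lexx. Qed.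

Lemma solution_bounded : exists A, forall t, 0 <= t -> `|x t| <= A.
Proof.
have [A HA] := value_radially_unbounded (V (x 0) + M).
exists A => t t0; rewrite leNgt; apply/negP => /HA.
have := @value_le 0 t; rewrite lexx t0 primitive0 subr0 => /(_ isT).
by have := LM t0; lra.
Qed.

(* Here [c x1 x2], [c = k / b], serves as a second Lyapunov function: its
   derivative is [c x1 f21(x1) > 0] up to terms that vanish with [x2] and [u],
   hence are controlled by the integrable running cost. *)
Lemma value_liminf v S : 0 < v -> 0 <= S -> exists2 s, S <= s & V (x s) < v.
Proof.
move=> v0 S0; apply: contrapT => noV.
have Vv t : S <= t -> v <= V (x t).
  by move=> St; rewrite leNgt; apply/negP => Vt; apply: noV; exists t.
have [A xA] := solution_bounded.
have A0 : 0 <= A := le_trans (normr_ge0 _) (xA 0 (lexx _)).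
pose K := (`[-A, A] `*` `[-A, A]) `&` [set p : R * R | v <= V p].
have Kx t : S <= t -> K (x t).
  move=> St; split; last exact: Vv.
  have := xA t (le_trans S0 St); rewrite prod_normE ge_max !ler_norml.
  by move=> /andP[? ?]; split; rewrite /= in_itv.
have cK : compact K.
  apply: compact_closedI; first by apply: compact_setX; exact: segment_compact.
  by apply: (@preimage_closed _ _ V [set y | v <= y]); [move=> p _; exact: value_continuous|exact: closed_ge].
(* The part of the derivative of [b^-1 k x1 x2] that is free of the input; the input adds
   [k x1 u]. *)
pose g p := b^-1 * k * (p.2 * f1 p.2 + p.1 * (f21 p.1 + f22 p.1 p.2)).
pose h (p : R * R) := f1 p.2 * f1 p.2.
have cf1 : continuous (fun p : R * R => f1 p.2).
  exact: continuous_fcomp (@continuous_snd _ _) f1_cont.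
have cg : continuous g.
  move=> p; apply: cvgM; first exact: cvg_cst.
  apply: cvgD; first by apply: cvgM; [exact: cvg_snd|exact: cf1].
  apply: cvgM; first exact: cvg_fst.
  apply: cvgD; last exact: f22_cont.
  exact: (continuous_fcomp (@continuous_fst _ _) f21_cont).
have ch : continuous h by move=> p; apply: cvgM; exact: cf1.
have h0 p : 0 <= h p by rewrite /h -expr2 sqr_ge0.
(* Here [h p = 0] means [p.2 = 0], where [f22] vanishes and [g p] is [p.1 * a1 p.1]; the bound
   [v <= V p] excludes the origin. *)
have gh p : K p -> h p = 0 -> 0 < g p.
  move=> [_ /= Vp] /eqP; rewrite mulf_eq0 orbb => /eqP fp.
  have p2 : p.2 = 0.
    have a2p : a2 p.2 = 0 by rewrite /a2 fp mulr0.
    case: (ltgtP p.2 0) => // /a2_incr; rewrite a2p a20 ltxx//.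
  have p1 : p.1 != 0.
    apply/negP => /eqP p1; move: Vp; rewrite VA p1 p2 A10 A20 addr0 mulr0.
    by rewrite leNgt v0.
  rewrite /g p2 f22_axis mul0r add0r addr0.
  rewrite (_ : _ * _ = p.1 * a1 p.1); last by rewrite /a1; ring.
  case: (ltgtP p.1 0) p1 => // p1 _.
    by rewrite nmulr_rgt0// -a10; exact: a1_incr.
  by rewrite pmulr_rgt0// -a10; exact: a1_incr.
have [n Hn] := compact_combination_gt0 cK cg ch h0 gh.
pose eta : R := n.+1%:R^-1.
have eta0 : 0 < eta by rewrite invr_gt0.
(* Young's inequality: [k x1 u >= - eta / 2 - C2 u^2] whenever [|x1| <= A]. *)
pose C2 := (k ^+ 2 * A ^+ 2) / (2 * eta).
have e20 : 0 <= 2 * eta by rewrite mulr_ge0// ltW.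
have C20 : 0 <= C2 by rewrite divr_ge0// mulr_ge0// sqr_ge0.
have k2 : 0 < k ^+ 2 by rewrite exprn_even_gt0.
(* The first summand charges [n f1^2] to the running cost, the second [C2 u^2]. *)
pose C3 := n%:R / (r * k ^+ 2) + C2 / r.
have r0 := ltW r_gt0.
have C30 : 0 <= C3 by rewrite addr_ge0// divr_ge0// mulr_ge0// ltW.
pose P s := (x s).2 * f1 (x s).2 + (x s).1 * (f2 (x s).1 (x s).2 + b * u s).
have pointwise s : S <= s -> eta / 2 + (- C3) * L s <= b^-1 * k * P s.
  move=> Ss; have [[x1A x2A] _] := Kx s Ss.
  have Hs : eta <= g (x s) + n%:R * h (x s) := Hn _ (Kx s Ss).
  have uE : b^-1 * k * P s = g (x s) + k * (x s).1 * u s.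
    by rewrite /P /g f2E; field.
  have HL : n%:R * h (x s) + C2 * u s ^+ 2 <= C3 * L s.
    have := lagrangian_lbound r_gt0 QE sign u x s.
    move=> /(ler_wpM2l C30); apply: le_trans; rewrite -subr_ge0.
    rewrite (_ : _ - _ = n%:R * (u s ^+ 2 / k ^+ 2) + C2 * (k ^+ 2 * f1 (x s).2 ^+ 2)).
      by apply: addr_ge0; apply: mulr_ge0 => //; [apply: divr_ge0|apply: mulr_ge0]; exact: sqr_ge0.
    by rewrite /C3 /h; field; rewrite k_neq0 gt_eqF.
  have amgm : - (eta / 2) - C2 * u s ^+ 2 <= k * (x s).1 * u s.
    have sq : 0 <= (eta + k * (x s).1 * u s) ^+ 2 / (2 * eta).
      by rewrite divr_ge0// sqr_ge0.
    have x1sq : (x s).1 ^+ 2 <= A ^+ 2.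
      rewrite -[leLHS]real_normK ?num_real// ler_sqr ?nnegrE// ler_norml.
      by move: x1A; rewrite /= in_itv.
    have : k ^+ 2 * (x s).1 ^+ 2 / (2 * eta) * u s ^+ 2 <= C2 * u s ^+ 2.
      by rewrite ler_wpM2r ?sqr_ge0// ler_wpM2r ?invr_ge0// ler_wpM2l// sqr_ge0.
    have E : (eta + k * (x s).1 * u s) ^+ 2 / (2 * eta) =
       eta / 2 + k * (x s).1 * u s + k ^+ 2 * (x s).1 ^+ 2 / (2 * eta) * u s ^+ 2.
      by field; rewrite gt_eqF.
    by move: sq; rewrite E; lra.
  by rewrite uE mulNr; lra.
have aP : allowable P.
  apply: allowableD.
    apply/continuous_allowable => s; apply: cvgM; first exact: (sol_cont2 sol).
    exact: (sol_f1 f1_cont sol).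
  by apply: allowableM; [exact: sol_cont1 sol|exact: sol_rhs2 sol].
(* Long enough for growth at rate [eta / 2] to exceed, by 1, the largest possible variation of
   [b^-1 k x1 x2] plus the total charge [C3 * M]. *)
pose T := S + (2 * (`|b^-1 * k| * A ^+ 2) + C3 * M + 1) / (eta / 2).
have M0 : 0 <= M := le_trans (cost_ge0 (lexx 0)) (LM (lexx 0)).
have num0 : 0 <= 2 * (`|b^-1 * k| * A ^+ 2) + C3 * M + 1.
  by rewrite !addr_ge0// ?mulr_ge0// sqr_ge0.
have ST : S <= T by rewrite lerDl divr_ge0// divr_ge0// ltW.
have T0 := le_trans S0 ST.
have prodE t : 0 <= t -> (x t).1 * (x t).2 = (x 0).1 * (x 0).2 + primitive P t.
  case: (sol) => _ _ X.
  exact: (product_rule (continuous_allowable (sol_f1 f1_cont sol))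
    (sol_rhs2 f2E f21_cont f22_cont sol) (sol_cont1 sol) (sol_cont2 sol)
    (fun t t0 => (X t t0).1) (fun t t0 => (X t t0).2)).
have aE : allowable (fun s => eta / 2 + (- C3) * L s).
  by apply: allowableD; [exact/continuous_allowable/cst_continuous|exact: allowableZ].
have := @le_primitiveB _ (fun s => eta / 2 + (- C3) * L s) (fun s => b^-1 * k * P s)
  S T aE (allowableZ _ aP).
rewrite S0 ST => /(_ isT (fun s sST => pointwise s (proj1 (andP sST)))).
rewrite !primitiveD ?primitiveZ//; try exact: allowableZ; try exact/continuous_allowable/cst_continuous.
rewrite !primitive_cst//.
have PB t : 0 <= t -> `|(x t).1 * (x t).2| <= A ^+ 2.
  move=> t0; have := xA t t0; rewrite prod_normE ge_max => /andP[h1 h2].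
  by rewrite normrM expr2 ler_pM.
have PTS : b^-1 * k * primitive P T - b^-1 * k * primitive P S <= 2 * (`|b^-1 * k| * A ^+ 2).
  rewrite (_ : _ - _ = b^-1 * k * ((x T).1 * (x T).2 - (x S).1 * (x S).2)); last first.
    by rewrite (prodE T T0) (prodE S S0); ring.
  apply: le_trans (ler_norm _) _; rewrite normrM mulrCA ler_wpM2l//.
  by apply: le_trans (ler_normB _ _) _; have := PB T T0; have := PB S S0; lra.
have JTS : C3 * (primitive L T - primitive L S) <= C3 * M.
  by rewrite ler_wpM2l//; have := LM T0; have := cost_ge0 S0; lra.
have : eta / 2 * T - eta / 2 * S = 2 * (`|b^-1 * k| * A ^+ 2) + C3 * M + 1.
  by rewrite /T; field; rewrite gt_eqF.
move: PTS JTS; rewrite mulrBr !mulNr; lra.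
Qed.

(** After a time [S] beyond which less than [e / 2] of cost remains, wait for an instant with
    [V < e / 2]; from then on [V] cannot climb above [e]. *)
Lemma value_cvg0 : V (x t) @[t --> +oo] --> (0 : R).
Proof.
apply/cvgrPdist_le => e e0.
have e2 : 0 < e / 2 by rewrite divr_gt0.
pose J := [set primitive L t | t in `[(0 : R), +oo[%classic].
have supJ : has_sup J.
  split; first by exists (primitive L 0), 0; rewrite //= in_itv/= lexx.
  by exists M => _ [t + <-]; rewrite /= in_itv/= andbT => /LM.
have [_ [S + <-] JS] := sup_adherent e2 supJ; rewrite /= in_itv/= andbT => S0.
have [s Ss Vs] := value_liminf e2 S0.
near=> t.
have st : s <= t by near: t; apply: nbhs_pinfty_ge; exact: num_real.
have s0 := le_trans S0 Ss; have t0 := le_trans s0 st.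
rewrite sub0r normrN ger0_norm ?value_ge0//.
have := @value_le s t; rewrite s0 st => /(_ isT).
have := @cost_le S s; rewrite S0 Ss => /(_ isT).
have : primitive L t <= sup J.
  by apply: ub_le_sup; [case: supJ|exists t; rewrite //= in_itv/= t0].
lra.
Unshelve. all: by end_near. Qed.

Lemma solution_cvg0 : x t @[t --> +oo] --> ((0, 0) : R * R).
Proof.
apply/cvgrPdist_lt => e e0; have [m m0 Hm] := value_small e0.
near=> t; rewrite distrC subr0; apply: Hm.
by near: t; apply: (cvgr_lt (0 : R) value_cvg0).
Unshelve. all: by end_near. Qed.

End decay.

End stability.

(** * Peano existence *)

Section peano.
Context {R : realType} (W : normedModType R) (G : W -> W) (M : R) (x0 : W).
Hypothesis GM : forall p, `|G p| <= M.

Let M0 : 0 <= M := le_trans (normr_ge0 _) (GM x0).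

Fixpoint euler (h : R) (n : nat) : W :=
  if n is m.+1 then euler h m + h *: G (euler h m) else x0.

Lemma euler_lipschitz h m n : 0 <= h ->
  `|euler h (m + n) - euler h m| <= n%:R * h * M.
Proof.
move=> h0; elim: n => [|n IH]; first by rewrite addn0 subrr normr0 !mul0r.
rewrite addnS /= addrAC; apply: le_trans (ler_normD _ _) _.
rewrite -natr1 !mulrDl mul1r; apply: lerD => //.
by rewrite normrZ ger0_norm// ler_wpM2l.
Qed.

Lemma euler_deviation h m n (q : W) e : 0 <= h ->
  (forall i, (i < n)%N -> `|G (euler h (m + i)) - q| <= e) ->
  `|euler h (m + n) - euler h m - (n%:R * h) *: q| <= n%:R * h * e.
Proof.
move=> h0; elim: n => [|n IH] Hq; first by rewrite addn0 subrr !mul0r scale0r subr0 normr0.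
have -> : euler h (m + n.+1) - euler h m - (n.+1%:R * h) *: q =
  (euler h (m + n) - euler h m - (n%:R * h) *: q) + h *: (G (euler h (m + n)) - q).
  rewrite addnS /= -natr1 mulrDl mul1r scalerDl scalerBr opprD !addrA.
  move: (euler h (m + n)) (euler h m) (h *: q) ((n%:R * h) *: q) => a c hq nq.
  by rewrite (addrAC a) (addrAC (a - c)).
apply: le_trans (ler_normD _ _) _; rewrite -natr1 !mulrDl mul1r; apply: lerD.
  by apply: IH => i ni; apply: Hq; rewrite ltnS ltnW.
by rewrite normrZ ger0_norm// ler_wpM2l// Hq.
Qed.

Hypothesis cG : continuous G.
Hypothesis ball_compact : forall A, compact [set p : W | `|p| <= A].

Let step (n : nat) : R := n.+1%:R^-1.
Let idx (n : nat) (t : R) := Num.truncn (t * n.+1%:R).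
Let approx (n : nat) (t : R) := euler (step n) (idx n t).

Let step_gt0 n : 0 < step n. Proof. by rewrite invr_gt0. Qed.

Let idx_itv n t : 0 <= t -> (idx n t)%:R * step n <= t < (idx n t)%:R * step n + step n.
Proof.
move=> t0; have := truncn_itv (mulr_ge0 t0 (ler0n R n.+1)).
rewrite -/(idx n t) /step => /andP[h1 h2].
rewrite ler_pdivrMr// h1 -[X in _ + X]mul1r -mulrDl natr1 ltr_pdivlMr//.
Qed.

Let idx_le n s t : s <= t -> (idx n s <= idx n t)%N.
Proof. by move=> st; apply: le_truncn; rewrite ler_wpM2r. Qed.

Let step_cvg : step n @[n --> \oo] --> (0 : R).
Proof. exact: (@cvg_harmonic R). Qed.

(** A cluster point of an ultrafilter is a limit: a neighbourhood whose preimage is not in [U] would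
    have its complement there, against clustering. *)
Lemma compact_ultra_cvg (T : Type) (U : set_system T) (K : set W) (f : T -> W) :
  UltraFilter U -> compact K -> (forall n, K (f n)) ->
  exists p : W, f n @[n --> U] --> p.
Proof.
move=> uU cK Kf.
have UK : U (f @^-1` K).
  by rewrite (_ : f @^-1` K = setT); [exact: filterT|apply/seteqP; split=> // n _; exact: Kf].
have [p [_ clp]] := cK (f @ U) _ UK.
exists p => B Bp; have [//|UnB] := in_ultra_setVsetC (f @^-1` B) uU.
by have [q []] := clp (~` B) B UnB Bp.
Qed.

Let approx_bounded n t : 0 <= t -> `|approx n t| <= `|x0| + t * M.
Proof.
move=> t0; have /andP[it _] := idx_itv n t0.
have := @euler_lipschitz (step n) 0 (idx n t) (ltW (step_gt0 n)).
rewrite add0n /= -/(approx n t) => h.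
have h2 : (idx n t)%:R * step n * M <= t * M by rewrite ler_wpM2r.
rewrite -(subrK x0 (approx n t)) addrC.
by apply: le_trans (ler_normD _ _) _; rewrite lerD2l (le_trans h).
Qed.

(** All Euler nodes between [a] and [b] stay within [(b - a + step n) * M] of [approx n s], hence in
    the ball where [G] is close to [q]. The extra [step n] comes from rounding [a] down to the
    grid. *)
Let local_estimate (n : nat) (s a b e d : R) (p q : W) :
  0 <= a -> a <= s <= b -> 0 < e ->
  (forall z, `|z - p| < d -> `|G z - q| <= e) ->
  `|approx n s - p| + (b - a + step n) * M < d ->
  `|approx n b - approx n a - ((idx n b)%:R * step n - (idx n a)%:R * step n) *: q|
   <= ((idx n b)%:R * step n - (idx n a)%:R * step n) * e.
Proof.
move=> a0 /andP[as_ sb] e0 Hd small.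
have st := step_gt0 n.
have s0 := le_trans a0 as_; have b0 := le_trans s0 sb.
have iab : (idx n a <= idx n b)%N by apply: idx_le; exact: le_trans as_ sb.
have ias := idx_le n as_; have isb := idx_le n sb.
rewrite -mulrBl -natrB// /approx -{1}(subnKC iab).
apply: euler_deviation; first exact: ltW.
move=> i ib; apply: Hd; apply: le_lt_trans small.
have lip (j l : nat) : (idx n a <= j <= l)%N -> (l <= idx n b)%N ->
    `|euler (step n) l - euler (step n) j| <= (b - a + step n) * M.
  move=> /andP[aj jl] lb; rewrite -(subnKC jl).
  apply: le_trans (euler_lipschitz j (l - j) (ltW st)) _; rewrite ler_wpM2r//.
  rewrite natrB// mulrBl.
  have /andP[ib1 _] := idx_itv n b0; have /andP[_ ia2] := idx_itv n a0.
  have : l%:R * step n <= (idx n b)%:R * step n by rewrite ler_wpM2r ?(ltW st)// ler_nat.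
  have : (idx n a)%:R * step n <= j%:R * step n by rewrite ler_wpM2r ?(ltW st)// ler_nat.
  lra.
set j := (idx n a + i)%N.
have jb : (j <= idx n b)%N by rewrite /j -(subnKC iab) leq_add2l ltnW.
have aj : (idx n a <= j)%N by rewrite leq_addr.
rewrite -(subrK (approx n s) (euler _ j)) -addrA addrC.
apply: le_trans (ler_normD _ _) _; rewrite lerD2l.
have [js|/ltnW sj] := leqP j (idx n s).
  by rewrite distrC; apply: lip; rewrite ?aj.
by apply: lip; rewrite ?ias.
Qed.

(* An ultrafilter limit of the Euler step functions replaces the Arzela-Ascoli
   extraction: pointwise convergence is enough, since the differential estimate
   at s involves only two instants at a time. *)
Lemma peano_existence : exists X : R -> W, X 0 = x0 /\
  forall s e, 0 <= s -> 0 < e -> exists2 d, 0 < d &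
    forall t, 0 <= t -> `|t - s| < d ->
    `|X t - X s - (t - s) *: G (X s)| <= e * `|t - s|.
Proof.
have [U [uU oU]] := @ultraFilterLemma nat \oo _.
have ex (t : R) : exists p : W, 0 <= t -> approx n t @[n --> U] --> p.
  have [t0|t0] := leP 0 t; last by exists x0.
  have [p hp] := compact_ultra_cvg uU (@ball_compact (`|x0| + t * M))
    (fun n => approx_bounded n t0).
  by exists p.
have [X HX] := choice ex.
have step_cvgU : step n @[n --> U] --> (0 : R).
  by move=> B /step_cvg; exact: oU.
exists X; split.
  have X0 : approx n 0 @[n --> U] --> x0.
    rewrite (_ : (fun n => _) = cst x0); first exact: cvg_cst.
    by apply/funext => n; rewrite /approx /idx mul0r truncn0.
  exact: cvg_unique (HX 0 (lexx 0)) X0.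
move=> s e s0 e0.
have /nbhs_ballP[d /= d0 Hd] : \forall z \near X s, `|G (X s) - G z| <= e.
  exact: (cvgrPdist_le _ _).1 (@cG (X s)) e e0.
have Gd z : `|z - X s| < d -> `|G z - G (X s)| <= e.
  by move=> zd; rewrite distrC; apply: Hd; rewrite -ball_normE /ball_/= distrC.
have M1 : 0 < M + 1 by have := M0; lra.
(* Budget for [d]: one half for motion between the instants, a quarter for the distance of
   [approx n s] to its limit, a quarter for grid rounding. [M + 1] covers [M = 0]. *)
exists (d / 2 / (M + 1)); first by rewrite !divr_gt0.
have idx_cvg (t : R) : 0 <= t -> (idx n t)%:R * step n @[n --> U] --> t.
  move=> t0; apply/cvgrPdist_lt => r r0.
  have H : \forall n \near U, `|0 - step n| < r by exact: (cvgrPdist_lt _ _).1 step_cvgU r r0.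
  apply: filterS H => n; rewrite sub0r normrN gtr0_norm// => sr.
  have /andP[h1 h2] := idx_itv n t0.
  by rewrite ger0_norm ?subr_ge0//; lra.
have key (a b : R) : 0 <= a -> a <= s <= b -> b - a < d / 2 / (M + 1) ->
    `|X b - X a - (b - a) *: G (X s)| <= e * (b - a).
  move=> a0 asb bad.
  have b0 : 0 <= b by case/andP: asb; lra.
  have lhs : `|approx n b - approx n a -
        ((idx n b)%:R * step n - (idx n a)%:R * step n) *: G (X s)|
       - ((idx n b)%:R * step n - (idx n a)%:R * step n) * e @[n --> U] -->
     `|X b - X a - (b - a) *: G (X s)| - (b - a) * e.
    have ba : (idx n b)%:R * step n - (idx n a)%:R * step n @[n --> U] --> b - a.
      by apply: cvgB; exact: idx_cvg.
    apply: cvgB; last by apply: cvgM => //; exact: cvg_cst.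
    apply: cvg_norm; apply: cvgB; first by apply: cvgB; exact: HX.
    by apply: cvgZr_tmp.
  rewrite mulrC -subr_le0; apply: (cvgr_to_le lhs).
  have d4 : 0 < d / 4 by rewrite divr_gt0.
  have near1 : \forall n \near U, `|approx n s - X s| < d / 4.
    have H : \forall n \near U, `|X s - approx n s| < d / 4.
      exact: (cvgrPdist_lt _ _).1 (HX s s0) _ d4.
    by apply: filterS H => n; rewrite distrC.
  have near2 : \forall n \near U, step n * M < d / 4.
    have H : \forall n \near U, `|0 - step n| < d / 4 / (M + 1).
      exact: (cvgrPdist_lt _ _).1 step_cvgU _ (divr_gt0 d4 M1).
    apply: filterS H => n; rewrite sub0r normrN gtr0_norm// ltr_pdivlMr// mulrDr mulr1.
    by have := step_gt0 n; lra.
  have baM : (b - a) * M <= d / 2.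
    have ab : 0 <= b - a by case/andP: asb; lra.
    by move: bad; rewrite ltr_pdivlMr// mulrDr mulr1; lra.
  apply: filterS2 near1 near2 => n n1 n2; rewrite subr_le0.
  by apply: (@local_estimate n s a b e d (X s)) => //; rewrite mulrDl; lra.
move=> t t0 ts; have [st|/ltW st] := leP s t.
  rewrite ger0_norm ?subr_ge0//; apply: key; rewrite ?lexx ?st//.
  by move: ts; rewrite ger0_norm ?subr_ge0.
rewrite ler0_norm ?subr_le0// opprB -normrN.
have -> : - (X t - X s - (t - s) *: G (X s)) = X s - X t - (s - t) *: G (X s).
  by rewrite opprB addrC opprB -scaleNr opprB.
apply: key; rewrite ?lexx ?st//.
by move: ts; rewrite ler0_norm ?subr_le0// opprB.
Qed.

End peano.

Lemma primitive_of_derivative (R : realType) (F f : R -> R) : continuous f ->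
  (forall s e, 0 <= s -> 0 < e -> exists2 d, 0 < d &
     forall t, 0 <= t -> `|t - s| < d -> `|F t - F s - (t - s) * f s| <= e * `|t - s|) ->
  forall t, 0 <= t -> F t = F 0 + primitive f t.
Proof.
move=> cf dF t; rewrite le_eqVlt => /predU1P[<-|t0]; first by rewrite primitive0 addr0.
(* The affine continuation with slope [f 0] turns the one-sided derivative at 0 into a two-sided
   one. *)
pose E s := if 0 <= s then F s else F 0 + s * f 0.
have EF s : 0 <= s -> E s = F s by rewrite /E => ->.
have dE (s : R) : 0 <= s -> is_derive s (1 : R) E (f s).
  move=> s0; apply/is_derive1P => e e0; have [d d0 Hd] := dF s e s0 e0.
  (* For [s > 0] the radius keeps the ball inside the positive half-line, so the continuation
     matters only at [s = 0]. *)
  pose d' := if s == 0 then d else Num.min d s.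
  have d'0 : 0 < d'.
    by rewrite /d'; case: eqVneq => // sn; rewrite lt_min d0 lt_neqAle eq_sym sn.
  have d'd : d' <= d by rewrite /d'; case: ifP => // _; rewrite ge_min lexx.
  apply/nbhs_ballP; exists d' => //= z; rewrite /ball/= distrC => zs.
  rewrite (EF s)// (mulrC (f s)); have [z0|z0] := leP 0 z.
    by rewrite EF//; apply: Hd => //; exact: lt_le_trans d'd.
  have s00 : s = 0.
    apply/eqP; apply: contraTT zs => sn; rewrite -leNgt /d' (negbTE sn) ge_min.
    by apply/orP; right; rewrite ler0_norm; lra.
  have -> : E z = F 0 + z * f 0 by rewrite /E leNgt z0.
  have -> : F 0 + z * f 0 - F s - (z - s) * f s = 0 by rewrite s00; ring.
  by rewrite normr0 mulr_ge0// ltW.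
have cE (s : R) : 0 <= s -> {for s, continuous E}.
  move=> /dE [dEs _]; apply: differentiable_continuous.
  exact/derivable1_diffP.
have FTC : (\int[lebesgue_measure]_(x in `[0%R, t]) (f x)%:E = (E t)%:E - (E 0)%:E)%E.
  apply: continuous_FTC2 => //; first exact: continuous_subspaceT.
    split.
    - by move=> s; rewrite in_itv/= => /andP[/ltW/dE[]].
    - by apply: cvg_at_right_filter; exact: cE.
    - by apply: cvg_at_left_filter; apply: cE; exact: ltW.
  by move=> s; rewrite in_itv/= => /andP[/ltW/dE[_ sE] _]; rewrite derive1E.
rewrite /primitive /Rintegral FTC -EFinB /= !EF ?lexx ?ltW//.
by rewrite addrC subrK.
Qed.

Lemma compact_plane_ball (R : realType) (A : R) : compact [set p : R * R | `|p| <= A].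
Proof.
have -> : [set p : R * R | `|p| <= A] = `[-A, A] `*` `[-A, A].
  apply/seteqP; split=> -[p q] /=; rewrite prod_normE ge_max !ler_norml/= !in_itv/=.
    by case/andP.
  by case=> -> ->.
by apply: compact_setX; exact: segment_compact.
Qed.

Lemma plane_ode_solution (R : realType) (G : R * R -> R * R) (M : R) (x0 : R * R) :
  continuous G -> (forall p, `|G p| <= M) ->
  exists y : R -> R * R, [/\ continuous y, y 0 = x0 & forall t, 0 <= t ->
    (y t).1 = x0.1 + primitive (fun s => (G (y s)).1) t /\
    (y t).2 = x0.2 + primitive (fun s => (G (y s)).2) t].
Proof.
move=> cG GM.
have [X [X0 dX]] := @peano_existence _ _ G M x0 GM cG (@compact_plane_ball R).
pose y t := X (Num.max 0 t).
have yX t : 0 <= t -> y t = X t by rewrite /y => /max_idPr ->.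
have cy : continuous y.
  move=> s; apply/cvgrPdist_lt => e e0.
  pose s' := Num.max 0 s; have s'0 : 0 <= s' by rewrite le_max lexx.
  have [d d0 Hd] := dX s' 1 s'0 ltr01.
  (* The differential estimate with tolerance 1 bounds increments of [X] from [s'] by [C] times the
     time elapsed. *)
  pose C := 1 + `|G (X s')|.
  have C0 : 0 < C by rewrite ltr_pwDl.
  apply/nbhs_ballP; exists (Num.min d (e / C)) => /=; first by rewrite lt_min d0 divr_gt0.
  move=> t; rewrite /ball/= distrC lt_min => /andP[td te].
  pose t' := Num.max 0 t; have t'0 : 0 <= t' by rewrite le_max lexx.
  have ts : `|t' - s'| <= `|t - s|.
    by rewrite /t' /s' !maxEle; case: ifPn; case: ifPn; rewrite -?ltNge => h1 h2;
      rewrite ler_norml; apply/andP; split; have := ler_norm (t - s); have := ler_norm (s - t);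
      rewrite (distrC s); lra.
  have := Hd t' t'0 (le_lt_trans ts td); rewrite mul1r => h.
  rewrite /y -/s' -/t' distrC.
  have -> : X t' - X s' = (X t' - X s' - (t' - s') *: G (X s')) + (t' - s') *: G (X s').
    by rewrite subrK.
  apply: le_lt_trans (ler_normD _ _) _.
  apply: (@le_lt_trans _ _ (`|t - s| * C)); last by rewrite -ltr_pdivlMr.
  rewrite /C mulrDr mulr1 normrZ; apply: lerD; first exact: le_trans ts.
  by rewrite ler_wpM2r.
have cGy : continuous (fun s => G (y s)) by exact: continuous_fcomp.
have y0 : y 0 = x0 by rewrite yX.
exists y; split=> // t t0; rewrite -[in X in X.1 + _]y0 -[in X in X.2 + _]y0; split.
- apply: (@primitive_of_derivative _ (fun s => (y s).1) (fun s => (G (y s)).1)) => //.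
    exact: continuous_fcomp cGy (@continuous_fst _ _).
  move=> s e s0 e0; have [d d0 Hd] := dX s e s0 e0; exists d => // z z0 zs.
  rewrite !yX//; apply: le_trans (Hd z z0 zs).
  by rewrite [leRHS]prod_normE le_max lexx.
- apply: (@primitive_of_derivative _ (fun s => (y s).2) (fun s => (G (y s)).2)) => //.
    exact: continuous_fcomp cGy (@continuous_snd _ _).
  move=> s e s0 e0; have [d d0 Hd] := dX s e s0 e0; exists d => // z z0 zs.
  rewrite !yX//; apply: le_trans (Hd z z0 zs).
  by rewrite [leRHS]prod_normE le_max lexx orbT.
Qed.

(** * The monotone case *)

Section optimal_stabilization.
Context {R : realType} (r b k : R) (f1 f21 : R -> R) (f22 f2 Q : R -> R -> R).
Context (V : R * R -> R).
Hypothesis r_gt0 : 0 < r.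
Hypothesis b_neq0 : b != 0.
Hypothesis k_neq0 : k != 0.
Hypothesis f2E : forall x1 x2, f2 x1 x2 = f21 x1 + f22 x1 x2.
Hypothesis f1_cont : continuous f1.
Hypothesis f21_cont : continuous f21.
Hypothesis f22_cont : continuous (fun p : R * R => f22 p.1 p.2).
Hypothesis QE : forall x1 x2, Q x1 x2 =
  r * k ^+ 2 * f1 x2 ^+ 2 + 2 * b^-1 * r * k * f1 x2 * f22 x1 x2.
Hypothesis sign : forall x1 x2, 0 <= b^-1 * k * f1 x2 * f22 x1 x2.
Hypothesis VE : forall x1 x2, V (x1, x2) =
  - 2 * b^-1 * r * k * (integral_from0 f1 x2 - integral_from0 f21 x1).
Hypothesis f1_0 : f1 0 = 0.
Hypothesis f21_0 : f21 0 = 0.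
Hypothesis a1_incr : {homo (fun y => b^-1 * k * f21 y) : x y / x < y}.
Hypothesis a2_incr : {homo (fun y => - (b^-1 * k) * f1 y) : x y / x < y}.

Let phi x2 := k * f1 x2.

Let cphi : continuous phi.
Proof. by move=> y; apply: cvgM; [exact: cvg_cst|exact: f1_cont]. Qed.

(* Rescaling the field to bound it keeps the value nonincreasing, so that the
   solutions of the rescaled field never leave the sublevel set on which the
   rescaling is trivial. *)
Lemma closed_loop_exists x0 : exists x, closed_loop f1 f2 b phi x0 x.
Proof.
pose G0 (p : R * R) := (f1 p.2, f2 p.1 p.2 + b * phi p.2).
have cG0 : continuous G0.
  have c1 : continuous (fun p : R * R => f1 p.2).
    exact: continuous_fcomp (@continuous_snd _ _) f1_cont.
  have c21 : continuous (fun p : R * R => f21 p.1).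
    exact: continuous_fcomp (@continuous_fst _ _) f21_cont.
  have c2 : continuous (fun p : R * R => f2 p.1 p.2 + b * phi p.2).
    rewrite (_ : (fun p => _) = fun p => f21 p.1 + f22 p.1 p.2 + b * (k * f1 p.2)); last first.
      by apply/funext => p; rewrite f2E.
    move=> p; apply: cvgD; first by apply: cvgD; [exact: c21|exact: f22_cont].
    by apply: cvgM; [exact: cvg_cst|apply: cvgM; [exact: cvg_cst|exact: c1]].
  by move=> p; apply: (@cvg_pair _ _ _ _ (nbhs (f1 p.2)) (nbhs (f2 p.1 p.2 + b * phi p.2)));
    [exact: c1|exact: c2].
have [A HA] := value_radially_unbounded r_gt0 f1_cont f21_cont VE f1_0 f21_0
  a1_incr a2_incr (V x0).
have [M M0 HM] : exists2 M, 0 < M & forall p, V p <= V x0 -> `|G0 p| <= M.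
  have /compact_bounded[M [_ HM]] : compact (G0 @` [set p : R * R | `|p| <= A]).
    by apply: continuous_compact; [exact: continuous_subspaceT|exact: compact_plane_ball].
  have M1 : M < `|M| + 1 by have := ler_norm M; lra.
  exists (`|M| + 1); first by rewrite ltr_wpDl.
  move=> p Vp; apply: (HM _ M1); exists p => //=.
  by rewrite leNgt; apply/negP => /HA; rewrite ltNge Vp.
(* Caps the speed at [M]: the factor is continuous, equals 1 where [|G0 p| <= M], and is
   nonnegative, which preserves the sign of the rate of [V]. *)
pose chi p := M / Num.max M `|G0 p|.
have max_gt0 p : 0 < Num.max M `|G0 p| by rewrite lt_max M0.
have chi_ge0 p : 0 <= chi p by rewrite divr_ge0// ltW.
have cchi : continuous chi.
  move=> p; apply: cvgM; first exact: cvg_cst.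
  apply: cvgV; first by rewrite gt_eqF.
  have c0 : {for p, continuous ((fun=> M) : R * R -> R)} by exact: cvg_cst.
  have c1 : {for p, continuous (fun p => `|G0 p|)} by apply: cvg_norm; exact: cG0.
  exact: (continuous_max c0 c1).
pose G p := chi p *: G0 p.
have cG : continuous G by move=> p; apply: cvgZ; [exact: cchi|exact: cG0].
have GM p : `|G p| <= M.
  rewrite normrZ ger0_norm// /chi mulrAC ler_pdivrMr// ler_pM2l//.
  by rewrite le_max lexx orbT.
have [y [cy y0 Hy]] := plane_ode_solution x0 cG GM.
have cGy : continuous (fun s => G (y s)) by exact: continuous_fcomp.
have Vy t : 0 <= t -> V (y t) <= V x0.
  move=> t0; rewrite -y0 in Hy *.
  rewrite (value_along f1_cont f21_cont VE cy
    (continuous_allowable (continuous_fcomp cGy (@continuous_fst _ _)))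
    (continuous_allowable (continuous_fcomp cGy (@continuous_snd _ _))) Hy t0).
  have wE s : 2 * r * (b^-1 * k) * (f21 (y s).1 * (G (y s)).1 - f1 (y s).2 * (G (y s)).2) =
      -1 * (chi (y s) * (2 * r * (b^-1 * k * f1 (y s).2 * f22 (y s).1 (y s).2) +
                         2 * r * (k * f1 (y s).2) ^+ 2)).
    have -> : (G (y s)).1 = chi (y s) * f1 (y s).2 by [].
    have -> : (G (y s)).2 = chi (y s) * (f2 (y s).1 (y s).2 + b * (k * f1 (y s).2)) by [].
    by rewrite f2E; move: (chi (y s) : R) => z; field.
  rewrite (_ : primitive _ t = - primitive (fun s => chi (y s) *
     (2 * r * (b^-1 * k * f1 (y s).2 * f22 (y s).1 (y s).2) +
      2 * r * (k * f1 (y s).2) ^+ 2)) t).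
    rewrite lerBlDr lerDl; apply: primitive_ge0 => s _.
    have r2 : 0 <= 2 * r by rewrite mulr_ge0// ltW.
    by apply: mulr_ge0 => //; apply: addr_ge0; apply: mulr_ge0 => //; exact: sqr_ge0.
  rewrite -mulN1r -primitiveZ//; first by apply: eq_primitive => s _; exact: wE.
  apply: continuous_allowable.
  have cf1 := continuous_fcomp (continuous_fcomp cy (@continuous_snd _ _)) f1_cont.
  have cf22 := continuous_fcomp cy f22_cont.
  move=> s; apply: cvgM; first exact: (continuous_fcomp cy cchi).
  apply: cvgD; (apply: cvgM; first exact: cvg_cst).
    by apply: cvgM; [apply: cvgM; [exact: cvg_cst|exact: cf1]|exact: cf22].
  by apply: cvgM; apply: cvgM; [exact: cvg_cst|exact: cf1|exact: cvg_cst|exact: cf1].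
have GE t : 0 <= t -> G (y t) = G0 (y t).
  move=> t0; rewrite /G /chi; have /HM GM0 := Vy t t0.
  by rewrite (max_idPl GM0) divff ?scale1r// gt_eqF.
exists y; split; first exact: continuous_subspaceT.
move=> t t0; have [-> ->] := Hy t t0; split; congr (_ + _);
  by apply: eq_primitive => s /andP[s0 _]; rewrite GE.
Qed.

(** [V] is nonnegative, so the exact energy balance under the feedback bounds the accumulated cost
    by [V x0], and the decay results apply with this bound. *)
Let closed_loop_data x0 x : closed_loop f1 f2 b phi x0 x ->
  exists y, [/\ solution b f1 f2 (fun t => phi (y t).2) y,
    y 0 = x0, forall t, 0 <= t -> y t = x t,
    allowable (fun s => lagrangian Q r (y s).1 (y s).2 (phi (y s).2)) &
    forall t, 0 <= t ->
      primitive (fun s => lagrangian Q r (y s).1 (y s).2 (phi (y s).2)) t <= V x0].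
Proof.
move=> cl; have [y [sy y0 yx]] := closed_loop_solution cphi cl.
exists y; split=> //.
  apply: continuous_allowable.
  exact: (continuous_closed_loop_lagrangian f1_cont f22_cont QE sy).
move=> t t0; rewrite -y0.
have := closed_loop_energy b_neq0 f2E f1_cont f21_cont f22_cont QE VE sy t0.
have := value_ge0 r_gt0 f1_cont f21_cont VE f1_0 f21_0 a1_incr a2_incr (y t).
by rewrite /phi; lra.
Qed.

Lemma closed_loop_cvg0 x0 x : closed_loop f1 f2 b phi x0 x ->
  x t @[t --> +oo] --> ((0, 0) : R * R).
Proof.
move=> /closed_loop_data[y [sy _ yx aL LV]]; apply: (cvg_eq_nneg yx).
exact: (solution_cvg0 r_gt0 b_neq0 k_neq0 f2E f1_cont f21_cont f22_cont QE sign VE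
  f1_0 f21_0 a1_incr a2_incr sy aL LV).
Qed.

Lemma value_terminal_condition x0 : terminal_condition f1 f2 b Q r phi V x0.
Proof.
have V0 u y M := @value_cvg0 _ _ _ _ _ _ _ _ _ _ r_gt0 b_neq0 k_neq0 f2E f1_cont
  f21_cont f22_cont QE sign VE f1_0 f21_0 a1_incr a2_incr u y M.
split=> [x /closed_loop_data[y [sy _ yx aL LV]]|u x adm].
  apply: (@cvg_eq_nneg _ _ (fun t => V (y t))) => [t t0|]; first by rewrite yx.
  exact: V0 sy aL LV.
have [y [sy y0 yx]] := admissible_solution adm.
rewrite (@eq_cost _ r Q u u x y)//; last by move=> t t0; rewrite yx.
move=> coo; apply: (@cvg_eq_nneg _ _ (fun t => V (y t))) => [t t0|]; first by rewrite yx.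
have [aL Lc] := finite_cost_lagrangian r_gt0 f1_cont f22_cont QE sign sy coo.
apply: (@V0 u y (fine (cost Q r u y)) sy aL) => t t0.
have c0 : (0 <= cost Q r u y)%E by apply: le_trans (Lc 0 (lexx 0)); rewrite primitive0.
have cE : (fine (cost Q r u y))%:E = cost Q r u y.
  by apply: fineK; rewrite ge0_fin_numE.
by rewrite -lee_fin cE; exact: Lc.
Qed.

(** Under the feedback the running cost is continuous in time, so the energy balance can be
    differentiated classically, with derivative [- L t]. Since [t > 0], nearby times are nonnegative
    and the normalized solution agrees with [x] there. *)
Lemma value_nonincreasing : nonincreasing_along_closed_loop f1 f2 b phi V.
Proof.
move=> x0 x /(closed_loop_solution cphi)[y [sy _ yx]] t t0.
pose L s := lagrangian Q r (y s).1 (y s).2 (phi (y s).2).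
have cL : continuous L.
  exact: (continuous_closed_loop_lagrangian f1_cont f22_cont QE sy).
have EV s := closed_loop_energy b_neq0 f2E f1_cont f21_cont f22_cont QE VE (t := s) sy.
have t1 : t < t + 1 by rewrite ltrDl.
have iL : lebesgue_measure.-integrable `[0, t + 1] (EFin \o L).
  by apply: (continuous_allowable cL); rewrite addr_ge0// ltW.
have [dP PE] := continuous_FTC1_closed t1 iL t0 (@cL t).
have dP' : is_derive t (1 : R) (primitive L) (L t).
  by split; [exact: dP|rewrite -derive1E; exact: PE].
have [dV VE'] : is_derive t (1 : R) (fun s => V (x s)) (- L t).
  apply/is_derive1P => e e0; have := (is_derive1P _ _ _).1 dP' e e0.
  apply: filter_app; near=> z.
  have z0 : 0 <= z by apply: ltW; near: z; exact: lt_nbhsr.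
  rewrite -(yx z z0) -(yx t (ltW t0)) (EV z z0) (EV t (ltW t0)) -normrN => h.
  apply: le_trans h; rewrite le_eqVlt; apply/predU1P; left; congr (`|_|).
  by rewrite /L /phi; ring.
split=> //; rewrite derive1E VE' oppr_le0.
exact: (lagrangian_ge0 r_gt0 QE sign (fun t => phi (y t).2) y).
Unshelve. all: by end_near. Qed.

Lemma origin_minimizer : closed_loop_minimizer Q r phi (0, 0).
Proof.
move=> q; rewrite [leLHS](_ : _ = 0).
  (* The bound is stated along curves; constant curves evaluate it at the point [q]. *)
  exact: (lagrangian_ge0 r_gt0 QE sign (fun=> phi q.2) (fun=> q) 0).
by rewrite /lagrangian QE /phi f1_0; ring.
Qed.

End optimal_stabilization.

Unset Implicit Arguments.
Set Strict Implicit.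

Theorem theorem2 (R : realType) (r b k : R)
    (f1 f21 : R -> R) (f22 f2 : R -> R -> R) (Q : R -> R -> R)
    (V : R * R -> R) (u2 : R -> R)
    (r_gt0 : 0 < r) (b_neq0 : b != 0)
    (f2E : forall x1 x2, f2 x1 x2 = f21 x1 + f22 x1 x2)
    (f1_cont : continuous f1) (f21_cont : continuous f21)
    (f22_cont : continuous (fun p : R * R => f22 p.1 p.2))
    (f1_0 : f1 0 = 0) (f2_0 : f2 0 0 = 0) (f22_0 : f22 0 0 = 0)
    (f1_nz : exists x2, f1 x2 != 0) (f21_nz : exists x1, f21 x1 != 0)
    (f2_nz : exists x1 x2, f2 x1 x2 != 0)
    (QE : forall x1 x2, Q x1 x2 =
       r * k ^+ 2 * f1 x2 ^+ 2 + 2 * b^-1 * r * k * f1 x2 * f22 x1 x2)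
    (sign : forall x1 x2, 0 <= b^-1 * k * f1 x2 * f22 x1 x2)
    (u2E : forall x2, u2 x2 = k * f1 x2)
    (VE : forall x1 x2, V (x1, x2) =
       - 2 * b^-1 * r * k * (integral_from0 f1 x2 - integral_from0 f21 x1)) :
  (forall x0 : R * R,
     (exists x, closed_loop f1 f2 b u2 x0 x) ->
     terminal_condition f1 f2 b Q r u2 V x0 ->
     optimal_feedback f1 f2 b Q r u2 x0 /\
     value_function f1 f2 b Q r x0 = (V x0)%:E) /\
  (C1 f1 -> C1 f21 ->
   (forall x2, x2 != 0 -> b^-1 * k * derive1 f1 x2 < 0) ->
   (forall x1, x1 != 0 -> 0 < b^-1 * k * derive1 f21 x1) ->
   [/\ forall x0 : R * R,
         optimal_feedback f1 f2 b Q r u2 x0 /\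
         value_function f1 f2 b Q r x0 = (V x0)%:E,
       positive_definite V /\ local_lyapunov f1 f2 b u2 V,
       radially_unbounded V -> global_lyapunov f1 f2 b u2 V,
       forall x0 x, closed_loop f1 f2 b u2 x0 x ->
         exists2 p : R * R, closed_loop_minimizer Q r u2 p &
           x t @[t --> +oo] --> p &
       convex_function [set: R * R * R]
         (fun z : R * R * R => lagrangian Q r z.1.1 z.1.2 z.2) ->
       forall x0 x, closed_loop f1 f2 b u2 x0 x ->
         x t @[t --> +oo] --> ((0, 0) : R * R)]).
Proof.
have {u2E} -> : u2 = (fun x2 => k * f1 x2) by exact/funext.
split=> [x0|[df1 _] [df21 _] f1' f21'].
  exact: (optimal_feedback_of_terminal_condition r_gt0 b_neq0 f2E f1_cont
    f21_cont f22_cont QE sign VE).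
(* With [k = 0] the strict slope condition at 1 would read [0 < 0]. *)
have k0 : k != 0.
  by apply: contraTneq (f1' 1 (oner_neq0 _)) => ->; rewrite mulr0 mul0r ltxx.
have f21_0 : f21 0 = 0 by rewrite -[RHS]f2_0 f2E f22_0 addr0.
have a1_incr : {homo (fun y => b^-1 * k * f21 y) : x y / x < y}.
  apply: derive_gt0_incr => [s|s s0]; first exact: derivableZ.
  by rewrite derive1E deriveZ//= -derive1E; exact: f21'.
have a2_incr : {homo (fun y => - (b^-1 * k) * f1 y) : x y / x < y}.
  apply: derive_gt0_incr => [s|s s0]; first exact: derivableZ.
  by rewrite derive1E deriveZ//= -derive1E /GRing.scale/= mulNr oppr_gt0; exact: f1'.
have VP := value_positive_definite r_gt0 f1_cont f21_cont VE f1_0 f21_0 a1_incr a2_incr.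
have VN := value_nonincreasing r_gt0 b_neq0 f2E f1_cont f21_cont f22_cont QE sign VE.
have cl0 x0 x := closed_loop_cvg0 r_gt0 b_neq0 k0 f2E f1_cont f21_cont f22_cont QE
  sign VE f1_0 f21_0 a1_incr a2_incr (x0 := x0) (x := x).
split.
- move=> x0; apply: (optimal_feedback_of_terminal_condition r_gt0 b_neq0 f2E
    f1_cont f21_cont f22_cont QE sign VE) => //.
    exact: (closed_loop_exists r_gt0 b_neq0 f2E f1_cont f21_cont f22_cont sign VE
      f1_0 f21_0 a1_incr a2_incr).
  exact: (value_terminal_condition r_gt0 b_neq0 k0 f2E f1_cont f21_cont f22_cont
    QE sign VE f1_0 f21_0 a1_incr a2_incr).
- split=> //; split=> //; split; first by case: VP.
  by exists setT => [|p _]; [exact: filterT|case: VP => _; exact].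
- by move=> Vrad; split.
- move=> x0 x cl; exists (0, 0); first exact: (origin_minimizer r_gt0 QE sign f1_0).
  exact: cl0 cl.
- by move=> _ x0 x cl; exact: cl0 cl.
Qed.
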